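(* Let $T$ be a rooted tree of depth $D$ whose leaves all lie at depth $D$, with vertex weights $w_u>0$, and let $1\le h\le k$ and $\delta := \frac{k-h+1/2}{k+1/2}$. There exists an online algorithm that, given requests $r_1,r_2,\ldots$ at leaves, maintains fractional solutions $x^t\in P_\delta$ with $x^t_{r_t,1}=\delta$ and $\sum_{\text{leaves } u} x^t_{u,1} = n-h$, such that for every horizon $T_0$ and any integer feasible solutions $y^t$ (i.e., $y^t\in P\cap\{0,1\}^N$ with $y^t_{r_t,1}=0$ for $t\ge1$), \[ \sum_{t=1}^{T_0}\|x^t-x^{t-1}\|_T \le O\big(D\log(1+1/\delta)\big)\cdot\sum_{t=1}^{T_0}\|y^t-y^{t-1}\|_T + C' = O\big(D\log(1+1/\delta)\big)\cdot\sum_{t=1}^{T_0} d(y^t,y^{t-1}) + C', \] where $C'$ depends only on $T,k,\delta$ (and $h$) but not on the input sequence, and where $d$ is evaluated on the restrictions of $y^t,y^{t-1}$ to the leaf atoms.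
   Context: Notation: $\mathbf r$ is the root; $n$ is the number of leaves, identified with $[n]$; $L_u$ is the set of leaves in the subtree $T_u$ of $u$. Atoms are pairs $(u,j)$ with $u$ a vertex and $j\in\{1,\ldots,|L_u|\}$; there are $N=n(D+1)$ atoms. For a non-leaf $u$, $\chi_u:=\{(v,\ell): v \text{ a child of } u,\ \ell\in[|L_v|]\}$. The anti-server polytope is $P:=\{x\in[0,1]^N : x_{\mathbf r,j}\ge \mathbf 1_{(j>h)}\ \forall j;\ \sum_{j\le|S|}x_{u,j}\le\sum_{(v,\ell)\in S}x_{v,\ell}\ \forall \text{ non-leaf } u,\ \forall S\subseteq\chi_u\}$, and $P_\delta:=P\cap\{x: x_{u,1}\ge\delta \text{ for all leaves } u\}$. An integral configuration of servers is encoded by $y_{\ell,1}=0$ if leaf $\ell$ has a server and $1$ otherwise, and $y_{u,j}=0$ if $T_u$ contains at least $j$ servers and $1$ otherwise. The tree norm is $\|x\|_T:=\sum_u w_u\sum_{j\in[|L_u|]}|x_{u,j}|$. For vectors $z,z'\in\mathbb R^n$ on the leaves, $d(z,z'):=\sum_u w_u\,|z(T_u)-z'(T_u)|$, where $z(T_u)$ is the sum of $z$ over the leaves of $T_u$ (the distance between two vertices being the sum of weights of vertices on the path between them).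
   Formalization: It is assumed that k < n (otherwise no x in P_δ has leaf sum n−h); both bounds hold for all integer feasible y, but the equality of the sums of ‖·‖_T and of d is claimed only when each y^t encodes a set of server leaves, since it fails for general 0/1 points of P. *)

(* Defs.v *)
From HB Require Import structures.
From mathcomp Require Import all_boot all_order all_algebra.
From mathcomp Require Import reals exp.
Set Implicit Arguments.
Unset Strict Implicit.
Unset Printing Implicit Defensive.
Import Order.TTheory GRing.Theory Num.Theory.
Local Open Scope ring_scope.

(* A finite rooted tree given by its parent function. The root is its own
   parent by convention, and every vertex reaches it by iterating [parent]. *)
Record rtree := RTree {
  vertex :> finType;
  root : vertex;
  parent : vertex -> vertex;
  parent_root : parent root = root;
  reach_root : forall v, fconnect parent v root }.
Arguments root T : rename.
Arguments parent {T} : rename.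

Section Tree.
Variable T : rtree.
Implicit Types u v : T.

Definition is_child v u : bool := (v != root T) && (parent v == u).

Definition is_leaf u : bool := [forall v, ~~ is_child v u].

(* [v] is a vertex of the subtree T_u. *)
Definition in_subtree u v : bool := fconnect parent v u.

(* [findex f x y] is the least number of iterations of f taking x to y. *)
Definition depth u : nat := findex parent u (root T).

Definition leaf := {u : T | is_leaf u}.
HB.instance Definition _ := Finite.on leaf.

Definition leaves_at_depth (D : nat) : Prop :=
  forall l : leaf, depth (val l) = D.

Definition nleaves : nat := #|{: leaf}|.

(* The set L_u. *)
Definition leaves u : {set leaf} := [set l : leaf | in_subtree u (val l)].

(* The second component is 0-based: j : 'I_#|L_u| stands for the atom
   (u, j + 1). *)
Definition atom := {u : T & 'I_#|leaves u|}.
HB.instance Definition _ := Finite.on atom.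

Definition mkatom u (j : 'I_#|leaves u|) : atom :=
  Tagged (fun u : T => 'I_#|leaves u|) j.

Definition chi u : {set atom} := [set a : atom | is_child (tag a) u].

Lemma leaf_leaves_gt0 (l : leaf) : (0 < #|leaves (val l)|)%N.
Proof.
by apply/card_gt0P; exists l; rewrite inE /in_subtree connect0.
Qed.

(* The atom (l, 1) of a leaf l. *)
Definition leaf_atom (l : leaf) : atom :=
  mkatom (Ordinal (leaf_leaves_gt0 l)).

End Tree.

Section Polytope.
Variables (R : realType) (T : rtree).
Implicit Types (x y : {ffun atom T -> R}) (z : {ffun leaf T -> R}).

(* The anti-server polytope P; [j.+1] is the 1-based index of the atom. *)
Definition antiserver (h : nat) x : Prop :=
  [/\ forall a : atom T, 0 <= x a <= 1,
      forall j : 'I_#|leaves (root T)|,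
        (h < j.+1)%N%:R <= x (mkatom j)
    & forall u : T, ~~ is_leaf u -> forall S : {set atom T}, S \subset chi u ->
        \sum_(j < #|leaves u| | (j.+1 <= #|S|)%N) x (mkatom j)
          <= \sum_(a in S) x a].

Definition antiserver_ge (h : nat) (delta : R) x : Prop :=
  antiserver h x /\ forall l : leaf T, delta <= x (leaf_atom l).

Definition integral x : Prop := forall a : atom T, x a = 0 \/ x a = 1.

(* The encoding of the configuration with one server at each leaf of A. *)
Definition config_vec (A : {set leaf T}) : {ffun atom T -> R} :=
  [ffun a : atom T =>
     if ((tagged a).+1 <= #|A :&: leaves (tag a)|)%N then 0 else 1].

Definition tree_norm (w : T -> R) x : R :=
  \sum_(u : T) w u * \sum_(j < #|leaves u|) `|x (mkatom j)|.

Definition leaf_restr x : {ffun leaf T -> R} :=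
  [ffun l : leaf T => x (leaf_atom l)].

Definition leaf_dist (w : T -> R) z z' : R :=
  \sum_(u : T) w u * `|\sum_(l in leaves u) z l - \sum_(l in leaves u) z' l|.

End Polytope.

Definition delta_of (R : realType) (h k : nat) : R :=
  (k%:R - h%:R + 2^-1) / (k%:R + 2^-1).

(* The requests r_1, ..., r_t; the value r 0 is never used. *)
Definition history (X : Type) (r : nat -> X) (t : nat) : seq X :=
  [seq r i | i <- iota 1 t].

(* Main.v *)
Require Import Defs.
From HB Require Import structures.
From mathcomp Require Import all_boot all_order all_algebra.
From mathcomp Require Import boolp classical_sets reals topology normedtype.
From mathcomp Require Import derive exp.
From mathcomp Require Import ring lra zify.
Set Implicit Arguments.
Unset Strict Implicit.
Unset Printing Implicit Defensive.
Import Order.TTheory GRing.Theory Num.Theory.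
Import numFieldNormedType.Exports.
Local Open Scope ring_scope.

(** On a request [r], the new state [x] is the Bregman projection of the old
    state [q], for the entropy of the coordinates weighted by [w] and shifted by
    [delta], onto the polyhedron of states with [x_r <= delta]. Duality is
    replaced by its variational form: the gradient
    [g_a = w_a ln ((x_a + delta) / (q_a + delta))] is nonnegative on every
    direction pointing into the polyhedron at [x].

    Single-coordinate directions show that [x] keeps all the total sums of [q]:
    the tight sets at a vertex are closed under union, and outside the largest
    one either a child atom could be lowered or an atom of the vertex raised
    towards [q]. This gives [x <= 1] and leaf sum [n - h].

    For the cost, the direction
    [D (y + delta) - (x + delta) (2 D - depth + [q < x]) / 2] is feasible for
    every adversary state [y] serving the request. Pairing it with [g], the
    movement is at most [4 D <g, y + delta>] plus telescoping terms, and
    [<g, y + delta>] is the decrease of the potential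
    [sum_a w_a (y_a + delta) ln ((1 + delta) / (x_a + delta))], which is
    [ln (1 + 1 / delta)]-Lipschitz in [y]. *)

(* [poly.root] shadows the root of a tree. *)
Local Notation root := Defs.root.

(** * Entropic projection onto a polyhedron *)

Section EntropicProjection.
Variables (R : realType) (X I : finType).
Variables (A : I -> X -> R) (b : I -> R).

Definition linval (i : I) (x : X -> R) : R := \sum_a A i a * x a.

Definition polyhedron (x : X -> R) : Prop := forall i, b i <= linval i x.

Variables (w : X -> R) (s : R).
Hypotheses (w_gt0 : forall a, 0 < w a) (s_gt0 : 0 < s).

(** The Bregman divergence of the weighted entropy shifted by [s], up to a term independent of [x].
    Subtracting [x a] leaves a pure logarithm as derivative. *)
Definition divergence (q x : X -> R) : R :=
  \sum_a w a * ((x a + s) * ln ((x a + s) / (q a + s)) - x a).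

Definition div_grad (q x : X -> R) (a : X) : R :=
  w a * ln ((x a + s) / (q a + s)).

Definition is_projection (q x : X -> R) : Prop :=
  polyhedron x /\ forall z, polyhedron z -> divergence q x <= divergence q z.

Lemma ln_le_subr1 (t : R) : 0 < t -> ln t <= t - 1.
Proof.
move=> t0; have /le_ln1Dx : -1 < t - 1 by lra.
by rewrite addrC subrK.
Qed.

(** The tangent bound on [ln] leaves only a quadratic error, which replaces differentiating the
    divergence. *)
Lemma div_term_le (t t' q : R) : 0 < t + s -> 0 < t' + s -> 0 < q + s ->
  ((t' + s) * ln ((t' + s) / (q + s)) - t') -
  ((t + s) * ln ((t + s) / (q + s)) - t) <=
  ln ((t + s) / (q + s)) * (t' - t) + (t' - t) ^+ 2 / (t + s).
Proof.
move=> t0 t'0 q0.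
rewrite !ln_div ?posrE //.
have H := @ln_le_subr1 ((t' + s) / (t + s)) (divr_gt0 t'0 t0).
rewrite ln_div ?posrE // in H.
have H2 : (t' + s) * (ln (t' + s) - ln (t + s)) <=
          (t' + s) * ((t' + s) / (t + s) - 1) by rewrite ler_pM2l.
have E : (t' + s) * ((t' + s) / (t + s) - 1) =
  (t' - t) ^+ 2 / (t + s) + (t' - t) by field; lra.
lra.
Qed.

(** Tight constraints allow any step and each slack one a positive step; finitely many such bounds
    have a positive minimum. *)
Lemma exists_feasible_step (al be : I -> R) :
  (forall i, 0 <= al i) -> (forall i, al i = 0 -> 0 <= be i) ->
  exists2 e : R, 0 < e & forall e', 0 < e' <= e ->
    forall i, 0 <= al i + e' * be i.
Proof.
move=> al0 tight.
have H : forall r : seq I, exists2 e : R, 0 < e & forall e', 0 < e' <= e ->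
    forall i, i \in r -> 0 <= al i + e' * be i.
  elim=> [|i r [e e0 He]]; first by exists 1.
  have [e1 e10 He1] : exists2 e1 : R, 0 < e1 &
      forall e', 0 < e' <= e1 -> 0 <= al i + e' * be i.
    have [a0|a0] := eqVneq (al i) 0.
      exists 1 => // e' /andP[e'0 _]; rewrite a0 add0r.
      by apply: mulr_ge0; [exact: ltW | exact: tight].
    have ai0 : 0 < al i by rewrite lt_def a0 al0.
    exists (al i / (`|be i| + 1)); first by rewrite divr_gt0 // ltr_wpDl.
    move=> e' /andP[e'0]; rewrite ler_pdivlMr ?ltr_wpDl // => le.
    have := ler_norm (- be i); rewrite normrN => Hn.
    have : e' * (- be i) <= e' * `|be i| by rewrite ler_pM2l.
    by nra.
  exists (Num.min e e1); first by rewrite lt_min e0 e10.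
  move=> e' /andP[e'0]; rewrite le_min => /andP[l1 l2] k.
  rewrite inE => /orP[/eqP->|kr]; first by rewrite He1 // e'0 l2.
  by apply: (He _ _ _ kr); rewrite e'0 l1.
have [e e0 He] := H (enum I); exists e => // e' he i.
by apply: (He _ he); rewrite mem_enum.
Qed.

Lemma linvalD i (x v : X -> R) (e : R) :
  linval i (fun a => x a + e * v a) = linval i x + e * linval i v.
Proof.
rewrite /linval mulr_sumr -big_split /=; apply: eq_bigr => a _.
ring.
Qed.

(** First-order optimality: a small step along [v] stays in the polyhedron, so minimality and
    [div_term_le] give [0 <= G + e' * Q] for all small [e']. *)
Lemma projection_variational (q x v : X -> R) :
  (forall z, polyhedron z -> forall a, 0 <= z a) -> (forall a, 0 <= q a) ->
  is_projection q x ->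
  (forall i, linval i x = b i -> 0 <= linval i v) ->
  0 <= \sum_a div_grad q x a * v a.
Proof.
move=> nonneg q0 [Px xmin] tight.
have [|i Hi|e e0 He] :=
  @exists_feasible_step (fun i => linval i x - b i) (fun i => linval i v).
- by move=> i; rewrite subr_ge0.
- by apply: tight; apply/eqP; rewrite -subr_eq0 Hi.
have x0 := nonneg _ Px.
set G := \sum_a _; set Q := \sum_a w a * (v a ^+ 2 / (x a + s)).
have key e' : 0 < e' <= e -> 0 <= G + e' * Q.
  move=> he; have e'0 : 0 < e' by case/andP: he.
  have Pz : polyhedron (fun a => x a + e' * v a).
    by move=> i; rewrite linvalD; have := He _ he i; lra.
  have z0 := nonneg _ Pz.
  have := xmin _ Pz; rewrite -subr_ge0 /divergence -sumrB => H.
  have : 0 <= e' * (G + e' * Q).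
    apply: (le_trans H); rewrite /G /Q mulrDr mulrA !mulr_sumr -big_split /=.
    apply: ler_sum => a _; rewrite -mulrBr /=.
    have := @div_term_le (x a) (x a + e' * v a) (q a).
    move=> /(_ (ltr_wpDl (x0 a) s_gt0) (ltr_wpDl (z0 a) s_gt0)
             (ltr_wpDl (q0 a) s_gt0)).
    move=> H1; rewrite -(ler_pM2l (w_gt0 a)) in H1; apply: (le_trans H1).
    rewrite /div_grad addrAC subrr add0r exprMn -subr_ge0.
    rewrite (_ : _ - _ = 0) //; ring.
  by rewrite pmulr_rge0.
have Q0 : 0 <= Q.
  apply: sumr_ge0 => a _; apply: mulr_ge0; first exact: ltW.
  by rewrite divr_ge0 ?sqr_ge0 // ltW // ltr_wpDl.
rewrite leNgt; apply/negP => G0.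
have Q1 : 0 < Q + 1 by rewrite ltr_wpDl.
(* If [G < 0], this step size gives [e2 * Q < - G], contradicting [key]. *)
pose e2 := Num.min e (- G / (2 * (Q + 1))).
have e20 : 0 < e2.
  by rewrite lt_min e0 divr_gt0 ?oppr_gt0 // mulr_gt0.
have := key e2; rewrite e20 ge_min lexx => /(_ isT).
have : e2 <= - G / (2 * (Q + 1)) by rewrite ge_min lexx orbT.
rewrite ler_pdivlMr ?mulr_gt0 //.
have : 0 <= e2 * Q by rewrite mulr_ge0 // ltW.
move=> P1 P2 P3; nra.
Qed.

Local Open Scope classical_set_scope.

Lemma continuous_sum_at (Y : topologicalType) (F : X -> Y -> R) (y : Y) :
  (forall a, {for y, continuous (F a)}) ->
  {for y, continuous (fun z => \sum_a F a z)}.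
Proof.
move=> cF; apply: cvg_big => //; first exact: add_continuous.
by move=> a _; apply: cF.
Qed.

(** Extreme value theorem: the polyhedron is closed in a cube, compact by Tychonoff, and [s > 0]
    keeps the arguments of the logarithms positive there. *)
Lemma projection_exists (q : X -> R) (M : R) :
  (forall z, polyhedron z -> forall a, 0 <= z a <= M) ->
  (forall a, 0 <= q a) -> (exists z, polyhedron z) ->
  exists x, is_projection q x.
Proof.
move=> bnd q0 [z0 Pz0].
pose E := prod_topology (fun _ : X => R : topologicalType).
have projc (a : X) : continuous (fun f : E => f a).
  exact: (@proj_continuous X (fun=> R : topologicalType) a).
pose K : set E := [set f | polyhedron f].
have cK : compact K.
  have cB := @tychonoff X (fun=> R : topologicalType) (fun=> `[0, M])
    (fun=> @segment_compact R 0 M).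
  apply: (subclosed_compact _ cB); last first.
    by move=> f Kf a; rewrite /= in_itv /=; apply: bnd.
  rewrite (_ : K = \bigcap_i [set f | b i <= linval i f]); last first.
    apply/seteqP; split => f Hf i; first by move=> _; apply: Hf.
    exact: (Hf i Logic.I).
  apply: closed_bigI => i _.
  apply: (@preimage_closed E R (linval i) [set t | b i <= t]);
    last exact: closed_ge.
  move=> f _; apply: continuous_sum_at => a.
  by apply: continuousM; [apply: cst_continuous | apply: projc].
have [|||c Kc cmin] := @compact_EVT_min E R (divergence q) K.
- by exists z0.
- by [].
- apply: continuous_in_subspaceT => f /set_mem Kf.
  apply: continuous_sum_at => a.
  have fa0 : 0 <= f a by case/andP: (bnd _ Kf a).
  have pos : 0 < f a + s by rewrite ltr_wpDl.
  have cs : {for f, continuous (fun g : E => g a + s)}.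
    by apply: continuousD; [apply: projc | apply: cst_continuous].
  apply: continuousM; first exact: cst_continuous.
  apply: continuousB; last exact: projc.
  apply: continuousM => //.
  apply: (@continuous_comp E R R (fun g : E => (g a + s) / (q a + s)) (@ln R)).
    by apply: continuousM => //; apply: cst_continuous.
  by apply: continuous_ln; rewrite divr_gt0 // ltr_wpDl.
exists c; split; first exact: set_mem.
by move=> z Pz; apply: cmin; apply: mem_set.
Qed.

End EntropicProjection.

(** * Leaves and atoms of a rooted tree *)

Section TreeFacts.
Variable T : rtree.
Implicit Types (u v : T) (l : leaf T) (a : atom T).

Definition idx a : nat := tagged a.

Lemma idx_lt a : (idx a < #|leaves (tag a)|)%N.
Proof. exact: ltn_ord. Qed.

Lemma depth_root : depth (root T) = 0%N.
Proof. exact: findex0. Qed.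

Lemma depth_child v u : is_child v u -> depth v = (depth u).+1.
Proof.
case/andP=> vr /eqP <-; rewrite /depth fconnect_findex //.
  exact: reach_root.
by rewrite eq_sym.
Qed.

Lemma depth_parent v : depth (parent v) = (depth v).-1.
Proof.
have [->|vr] := eqVneq v (root T); first by rewrite parent_root depth_root.
by rewrite (@depth_child v (parent v)) // /is_child vr eqxx.
Qed.

Lemma depth_iter n v : depth (iter n parent v) = (depth v - n)%N.
Proof. by elim: n => [|n IH] /=; rewrite ?subn0 // depth_parent IH subnS. Qed.

Lemma depth_eq0 v : (depth v == 0%N) = (v == root T).
Proof. exact: findex_eq0. Qed.

Lemma iter_parent_root n : iter n parent (root T) = root T.
Proof. by elim: n => //= n ->; rewrite parent_root. Qed.

(** An ancestor is determined by its depth; this gives uniqueness of the child above a given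
    vertex. *)
Lemma in_subtreeE u v : in_subtree u v -> iter (depth v - depth u) parent v = u.
Proof.
move=> /iter_findex; set m := findex _ _ _ => <-; rewrite depth_iter.
have [le_m|lt_m] := leqP m (depth v); first by rewrite subKn.
have vr : iter (depth v) parent v = root T.
  by apply: iter_findex; apply: reach_root.
rewrite (_ : (depth v - m = 0)%N) ?subn0 ?vr; last first.
  by apply/eqP; rewrite subn_eq0 ltnW.
by rewrite -(subnK (ltnW lt_m)) iterD vr iter_parent_root.
Qed.

Lemma in_subtree_root v : in_subtree (root T) v.
Proof. exact: reach_root. Qed.

Lemma depth_in_subtree u v : in_subtree u v -> (depth u <= depth v)%N.
Proof. by move=> /iter_findex <-; rewrite depth_iter leq_subr. Qed.

Lemma child_nonleaf v u : is_child v u -> ~~ is_leaf u.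
Proof. by move=> vu; apply/forallPn; exists v; rewrite negbK. Qed.

Lemma child_in_subtree u v x : is_child v u -> in_subtree v x -> in_subtree u x.
Proof.
case/andP=> _ /eqP <- vx; apply: connect_trans vx _; exact: fconnect1.
Qed.

Lemma in_subtree_child u x : in_subtree u x -> x != u ->
  exists2 v, is_child v u & in_subtree v x.
Proof.
move=> ux neq; have := iter_findex ux; rewrite /in_subtree in ux.
case E : (findex _ _ _) => [|n] /=.
  by move/eqP: E; rewrite findex_eq0 (negPf neq).
move=> Hn; exists (iter n parent x); last exact: fconnect_iter.
rewrite /is_child Hn eqxx andbT; apply/eqP => H.
(* If the vertex before [u] on the path were the root, [u] would be the root too and would have been
   reached one iteration earlier. *)
have ur : u = root T by rewrite -Hn H parent_root.
have le : (findex parent x u <= n)%N.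
  rewrite leqNgt; apply/negP => lt.
  have := findex_max ux; rewrite E => lo.
  have : findex parent x (iter n parent x) = n by apply: findex_iter; apply: ltnW.
  by rewrite H -ur E; lia.
by rewrite E ltnn in le.
Qed.

Lemma child_uniq u v v' x : is_child v u -> is_child v' u ->
  in_subtree v x -> in_subtree v' x -> v = v'.
Proof.
move=> /depth_child d /depth_child d' /in_subtreeE <- /in_subtreeE <-.
by rewrite d d'.
Qed.

Lemma leaves_leaf l : leaves (val l) = [set l].
Proof.
apply/setP => l'; rewrite !inE; apply/idP/eqP => [H|->]; last exact: connect0.
apply/val_inj; apply/eqP/negPn/negP => /(in_subtree_child H)[v /child_nonleaf].
by rewrite (valP l).
Qed.

Lemma leaves_root : leaves (root T) = [set: leaf T].
Proof. by apply/setP => l; rewrite !inE in_subtree_root. Qed.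

Lemma card_leaves_root : #|leaves (root T)| = nleaves T.
Proof. by rewrite leaves_root cardsT. Qed.

(** Double counting: each leaf below the non-leaf [u] lies below exactly one child. *)
Lemma card_children (A : {set leaf T}) u : ~~ is_leaf u ->
  (\sum_(v | is_child v u) #|A :&: leaves v| = #|A :&: leaves u|)%N.
Proof.
move=> nu; under eq_bigr do rewrite -sum1_card big_mkcond.
rewrite -sum1_card exchange_big /= [RHS]big_mkcond /=; apply: eq_bigr => l _.
rewrite -big_mkcondr sum1_card /=.
case: ifP => [|/negbT].
  rewrite !inE => /andP[lA ul].
  have [|v vu vl] := in_subtree_child ul.
    by apply: contraNneq nu => <-; apply: valP.
  rewrite (eq_card (_ : _ =i pred1 v)) ?card1 // => v'.
  rewrite [LHS]unfold_in /= !inE lA /=.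
  apply/idP/eqP => [/andP[v'u v'l]|->]; last by rewrite vu vl.
  exact: child_uniq v'u vu v'l vl.
rewrite !inE => H; apply: eq_card0 => v; rewrite [LHS]unfold_in /=; apply/negP.
move=> /andP[vu]; rewrite !inE => /andP[lA vl]; move: H.
by rewrite lA (child_in_subtree vu vl).
Qed.

Lemma sum_atoms (M : nmodType) (P : pred T) (Q : atom T -> bool)
    (F : atom T -> M) :
  \sum_(a | P (tag a) && Q a) F a =
  \sum_(v | P v) \sum_(j < #|leaves v| | Q (mkatom j)) F (mkatom j).
Proof.
rewrite (sig_big_dep P (fun v (j : 'I_#|leaves v|) => Q (mkatom j))
  (fun v (j : 'I_#|leaves v|) => F (mkatom j))) /=.
by apply: eq_big => [[v j]|[v j] _].
Qed.

Lemma sum_atoms_at (M : nmodType) u (Q : pred nat) (F : atom T -> M) :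
  \sum_(a | (tag a == u) && Q (idx a)) F a =
  \sum_(j < #|leaves u| | Q j) F (mkatom j).
Proof. by rewrite (sum_atoms (pred1 u) (Q \o idx)) big_pred1_eq. Qed.

Lemma card_chi u : ~~ is_leaf u -> #|chi u| = #|leaves u|.
Proof.
move=> nu; rewrite -[RHS](eq_card (_ : [set: leaf T] :&: leaves u =i _)); last first.
  by move=> l; rewrite !inE.
rewrite -card_children // -sum1_card.
under eq_bigl do rewrite inE -[is_child _ _]andbT.
rewrite (@sum_atoms nat (fun v => is_child v u) xpredT) /=; apply: eq_bigr => v _.
by rewrite finset.setTI sum1_card card_ord.
Qed.

Lemma leaf_atomE a (H : is_leaf (tag a)) : a = leaf_atom (Sub (tag a) H).
Proof.
case: a H => u j H; rewrite /leaf_atom /mkatom /=.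
have c1 : #|leaves u| = 1%N by rewrite (leaves_leaf (Sub u H)) cards1.
congr Tagged; apply/val_inj => /=.
by have := ltn_ord j; rewrite {2}c1; case: (nat_of_ord j).
Qed.

Lemma sum_leaf_atoms (M : nmodType) (F : atom T -> M) :
  \sum_(a | is_leaf (tag a)) F a = \sum_(l : leaf T) F (leaf_atom l).
Proof.
rewrite (reindex_omap (fun l => leaf_atom l) (fun a => insub (tag a))); last first.
  by move=> a Ha; rewrite insubT /= -leaf_atomE.
apply: eq_bigl => l /=; rewrite (valP l) /=.
by rewrite valK eqxx.
Qed.

Variable D : nat.
Hypothesis leavesD : leaves_at_depth T D.

Lemma depth_le u : (0 < #|leaves u|)%N -> (depth u <= D)%N.
Proof.
case/card_gt0P => l; rewrite inE => /depth_in_subtree.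
by rewrite (leavesD l).
Qed.

Lemma depth_atom a : (depth (tag a) <= D)%N.
Proof. by apply: depth_le; apply: leq_ltn_trans (idx_lt a). Qed.

(** Stated for atoms because an atom guarantees a leaf below its vertex; at depth [D] that leaf is
    the vertex itself. *)
Lemma is_leaf_depth a : is_leaf (tag a) = (depth (tag a) == D).
Proof.
apply/idP/eqP => [H|dD]; first exact: (leavesD (Sub (tag a) H)).
have : (0 < #|leaves (tag a)|)%N by apply: leq_ltn_trans (idx_lt a).
case/card_gt0P => l; rewrite inE => /in_subtreeE.
by rewrite (leavesD l) dD subnn /= => <-; apply: valP.
Qed.

Lemma sum_level (M : nmodType) (F : atom T -> M) d :
  \sum_(a | depth (tag a) == d.+1) F a =
  \sum_(u | depth u == d) \sum_(a in chi u) F a.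
Proof.
rewrite (partition_big (fun a => parent (tag a)) (fun u => depth u == d)) /=.
  apply: eq_bigr => u /eqP du; apply: eq_bigl => a; rewrite inE /is_child.
  apply/andP/andP => [[/eqP da /eqP <-]|[ar /eqP pu]].
    by split=> //; rewrite -depth_eq0 da.
  by rewrite pu eqxx (@depth_child _ u) ?du // /is_child ar pu eqxx.
by move=> a /eqP da; rewrite depth_parent da.
Qed.

Lemma sum_level_tag (M : nmodType) (F : atom T -> M) d :
  \sum_(a | depth (tag a) == d) F a =
  \sum_(u | depth u == d) \sum_(a | tag a == u) F a.
Proof.
rewrite (partition_big tag (fun u => depth u == d)) //=.
apply: eq_bigr => u /eqP du; apply: eq_bigl => a.
by have [->|] := eqVneq (tag a) u; rewrite ?du ?eqxx ?andbF.
Qed.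

(** By hypothesis the sum over each level is at most the sum over the next; the chain runs from the
    root to depth [D]. *)
Lemma leaf_sum_ge (R : realDomainType) (x : atom T -> R) :
  (forall u, ~~ is_leaf u ->
     \sum_(a | tag a == u) x a <= \sum_(a in chi u) x a) ->
  \sum_(a | tag a == root T) x a <= \sum_(l : leaf T) x (leaf_atom l).
Proof.
move=> H.
have step d : (d <= D)%N ->
    \sum_(a | tag a == root T) x a <= \sum_(a | depth (tag a) == d) x a.
  elim: d => [_|d IH dD]; first by under [leRHS]eq_bigl do rewrite depth_eq0.
  apply: (le_trans (IH (ltnW dD))); rewrite sum_level sum_level_tag.
  apply: ler_sum => u /eqP du; apply: H; apply/negP => ul.
  by have := leavesD (Sub u ul); rewrite /= du => E; rewrite E ltnn in dD.
by rewrite -sum_leaf_atoms [leRHS](eq_bigl _ _ is_leaf_depth) step.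
Qed.

End TreeFacts.

(** * Prefix sums at a vertex and their supermodularity *)

Lemma convex_increments (R : realDomainType) (p : nat -> R) (m : nat) :
  (forall n n', (n <= n' < m)%N -> p n.+1 - p n <= p n'.+1 - p n') ->
  forall c d e, (c + e + d <= m)%N ->
  p (c + d)%N - p c <= p (c + e + d)%N - p (c + e)%N.
Proof.
move=> H c d e; elim: d => [|d IH] le; first by rewrite !addn0 !subrr.
have /IH : (c + e + d <= m)%N by lia.
have := H (c + d)%N (c + e + d)%N; rewrite !addnS => /(_ _)/wrap[]; first by lia.
lra.
Qed.

Lemma sum_indic (R : pzSemiRingType) (X : finType) (P : pred X) (b : X) :
  \sum_(a | P a) (a == b)%:R = (P b)%:R :> R.
Proof.
rewrite big_mkcond (bigD1 b) //= big1 ?addr0 => [|a /negPf->]; last by case: ifP.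
by rewrite eqxx; case: (P b).
Qed.

Section Prefix.
Variables (R : realDomainType) (T : rtree).
Implicit Types (u v : T) (a b : atom T) (x y : atom T -> R) (S : {set atom T}).

(** The left side of the polytope inequality for a set of [n] child atoms. *)
Definition prefix_sum x u (n : nat) : R :=
  \sum_(a | (tag a == u) && (idx a < n)%N) x a.

Lemma atom_inj a b : tag a = tag b -> idx a = idx b -> a = b.
Proof.
case: a b => [u i] [v j] /= uv; case: v / uv j => j ij.
by congr Tagged; apply: val_inj.
Qed.

Lemma prefix_sumS x u n (H : (n < #|leaves u|)%N) :
  prefix_sum x u n.+1 = prefix_sum x u n + x (mkatom (Ordinal H)).
Proof.
rewrite /prefix_sum (bigD1 (mkatom (Ordinal H))) /= ?eqxx ?ltnSn // addrC.
congr (_ + _); apply: eq_bigl => a; rewrite -andbA ltnS leq_eqVlt.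
have [tu /=|//] := eqVneq (tag a) u.
have [->|ne] := eqVneq a (mkatom (Ordinal H)); first by rewrite /= ltnn andbF.
rewrite andbT; have [E|//] := eqVneq (idx a) n.
by case/eqP: ne; apply: atom_inj.
Qed.

Lemma prefix_sum_all x u n : (#|leaves u| <= n)%N ->
  prefix_sum x u n = \sum_(a | tag a == u) x a.
Proof.
move=> le; apply: eq_bigl => a; have [E|//] := eqVneq (tag a) u.
by rewrite (leq_trans (idx_lt a)) // E.
Qed.

(** Monotonicity in the index makes the prefix sum convex in [n], and the sizes of union and
    intersection have the same total as those of [S1] and [S2] but lie at least as far apart. *)
Lemma prefix_sum_supermodular x u S1 S2 : ~~ is_leaf u ->
  (forall a b, tag a = tag b -> (idx a <= idx b)%N -> x a <= x b) ->
  S1 \subset chi u -> S2 \subset chi u ->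
  prefix_sum x u #|S1| + prefix_sum x u #|S2| <=
  prefix_sum x u #|S1 :|: S2| + prefix_sum x u #|S1 :&: S2|.
Proof.
move=> nu mono s1 s2.
have cU : (#|S1 :|: S2| <= #|leaves u|)%N.
  by rewrite -card_chi // subset_leq_card // finset.subUset s1 s2.
have cc : (#|S1 :|: S2| + #|S1 :&: S2| = #|S1| + #|S2|)%N.
  rewrite cardsU subnK //; apply: leq_trans (leq_addr _ _).
  exact: subset_leq_card (finset.subsetIl S1 S2).
have c1 := subset_leq_card (finset.subsetIl S1 S2).
have c2 := subset_leq_card (finset.subsetIr S1 S2).
have inc n n' : (n <= n' < #|leaves u|)%N ->
    prefix_sum x u n.+1 - prefix_sum x u n <=
    prefix_sum x u n'.+1 - prefix_sum x u n'.
  case/andP=> nn' n'm; have nm := leq_ltn_trans nn' n'm.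
  rewrite (prefix_sumS _ nm) (prefix_sumS _ n'm).
  by rewrite !(addrAC _ (x _)) !subrr !add0r mono.
have := @convex_increments _ (prefix_sum x u) _ inc #|S1 :&: S2|
  (#|S1| - #|S1 :&: S2|) (#|S2| - #|S1 :&: S2|).
rewrite !subnKC //; move=> /(_ _)/wrap[]; first by lia.
rewrite (_ : (#|S2| + (#|S1| - #|S1 :&: S2|) = #|S1 :|: S2|)%N); last by lia.
by rewrite lerBrDr addrAC lerBlDr.
Qed.

End Prefix.

(** * The projection step preserves the total sums *)

Section Invariant.
Variables (R : realType) (T : rtree) (D : nat) (w : T -> R) (h : nat).
Variable delta : R.
Hypotheses (leavesD : leaves_at_depth T D) (D_gt0 : (0 < D)%N).
Hypotheses (w_gt0 : forall u, 0 < w u) (delta_gt0 : 0 < delta).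
Implicit Types (u v : T) (a b : atom T) (q x y : atom T -> R).
Implicit Types (S : {set atom T}) (r : leaf T).

Lemma root_nonleaf : ~~ is_leaf (root T).
Proof.
apply/negP => H; move: D_gt0.
by rewrite -(leavesD (Sub (root T) H)) /= depth_root.
Qed.

(** The leaf bound of [P_delta], the root bound of [P], and 0 elsewhere. With 0-based indices,
    [h < j.+1] reads [h <= idx a]. *)
Definition lower a : R :=
  if is_leaf (tag a) then delta
  else if tag a == root T then (h <= idx a)%N%:R else 0.

Lemma lower_ge0 a : 0 <= lower a.
Proof. by rewrite /lower; case: ifP => _; [exact: ltW | case: ifP]. Qed.

Lemma lower_mono a b : tag a = tag b -> (idx a <= idx b)%N -> lower a <= lower b.
Proof.
rewrite /lower => -> le; case: ifP => // _; case: ifP => // _.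
by rewrite ler_nat; case: (leqP h (idx a)) => // ha; rewrite (leq_trans ha le).
Qed.

Definition dominated x : Prop := forall u S, ~~ is_leaf u -> S \subset chi u ->
  prefix_sum x u #|S| <= \sum_(a in S) x a.

(* The upper bound 2 only makes the feasible set compact: the projection turns
   out to be bounded by 1, so it never interferes. *)
Definition feasible r x : Prop :=
  [/\ forall a, lower a <= x a <= 2, x (leaf_atom r) <= delta & dominated x].

(** Finite index type of the inequalities in [feasible]: lower bounds, upper bounds, the request,
    and pairs of a vertex and a set. An inadmissible pair encodes [0 <= 0]. *)
Definition constr : Type := (atom T + atom T + unit + T * {set atom T})%type.
HB.instance Definition _ := Finite.on constr.

Definition constr_coef r (i : constr) a : R :=
  match i with
  | inl (inl (inl b)) => (a == b)%:R
  | inl (inl (inr b)) => - (a == b)%:R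
  | inl (inr _) => - (a == leaf_atom r)%:R
  | inr (u, V) => if ~~ is_leaf u && (V \subset chi u) then
      (a \in V)%:R - ((tag a == u) && (idx a < #|V|)%N)%:R else 0
  end.

Definition constr_bound (i : constr) : R :=
  match i with
  | inl (inl (inl b)) => lower b
  | inl (inl (inr b)) => - 2
  | inl (inr _) => - delta
  | inr _ => 0
  end.

Lemma sum_indicM (X : finType) (P : pred X) (F : X -> R) :
  \sum_a (P a)%:R * F a = \sum_(a | P a) F a.
Proof.
by rewrite [RHS]big_mkcond; apply: eq_bigr => a _; case: (P a); rewrite ?mul1r ?mul0r.
Qed.

Lemma linval_constr r (i : constr) x : linval (constr_coef r) i x =
  match i with
  | inl (inl (inl b)) => x b
  | inl (inl (inr b)) => - x b
  | inl (inr _) => - x (leaf_atom r)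
  | inr (u, V) => if ~~ is_leaf u && (V \subset chi u) then
      \sum_(a in V) x a - prefix_sum x u #|V| else 0
  end.
Proof.
rewrite /linval; case: i => [[[b|b]|?]|[u S]] /=.
- by rewrite (sum_indicM (pred1 b)) big_pred1_eq.
- under eq_bigr do rewrite mulNr.
  by rewrite sumrN (sum_indicM (pred1 b)) big_pred1_eq.
- under eq_bigr do rewrite mulNr.
  by rewrite sumrN (sum_indicM (pred1 _)) big_pred1_eq.
- case: ifP => _; last by under eq_bigr do rewrite mul0r; rewrite big1.
  under eq_bigr do rewrite mulrBl.
  by rewrite sumrB (sum_indicM (mem S)) (sum_indicM (fun a => _ && _)).
Qed.

Lemma polyhedronE r x :
  polyhedron (constr_coef r) constr_bound x <-> feasible r x.
Proof.
split=> [H|[box req dom] i].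
  split=> [a||u S nu su].
  - have := H (inl (inl (inl a))); have := H (inl (inl (inr a))).
    by rewrite !linval_constr /= lerN2 => -> ->.
  - by have := H (inl (inr tt)); rewrite linval_constr /= lerN2.
  - by have := H (inr (u, S)); rewrite linval_constr /= nu su /= subr_ge0.
rewrite linval_constr; case: i => [[[b|b]|?]|[u S]] //=.
- by case/andP: (box b).
- by rewrite lerN2; case/andP: (box b).
- by rewrite lerN2.
- by case: ifP => // /andP[nu su]; rewrite subr_ge0 dom.
Qed.

Definition wat a : R := w (tag a).

Lemma wat_gt0 a : 0 < wat a.
Proof. exact: w_gt0. Qed.

Definition step_to r q x : Prop :=
  is_projection (constr_coef r) constr_bound wat delta q x.

Local Notation grad := (div_grad wat delta).

Lemma tangent r q x (v : atom T -> R) : (forall a, 0 <= q a) -> step_to r q x ->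
  (forall a, x a = lower a -> 0 <= v a) -> (forall a, x a = 2 -> v a <= 0) ->
  (x (leaf_atom r) = delta -> v (leaf_atom r) <= 0) ->
  (forall u S, ~~ is_leaf u -> S \subset chi u ->
     prefix_sum x u #|S| = \sum_(a in S) x a ->
     prefix_sum v u #|S| <= \sum_(a in S) v a) ->
  0 <= \sum_a grad q x a * v a.
Proof.
move=> q0 xP H1 H2 H3 H4.
apply: (projection_variational (A := constr_coef r) (b := constr_bound)) => //.
- by move=> a; apply: w_gt0.
- by move=> z /polyhedronE[box _ _] a; case/andP: (box a) => /(le_trans (lower_ge0 a)).
move=> i; rewrite !linval_constr; case: i => [[[b|b]|?]|[u S]] /=.
- exact: H1.
- by move/oppr_inj => E; rewrite oppr_ge0 H2.
- by move/oppr_inj => E; rewrite oppr_ge0 H3.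
- case: ifP => // /andP[nu su] /eqP; rewrite subr_eq0 => /eqP E.
  by rewrite subr_ge0 H4.
Qed.

Lemma grad_gt0 q x a : 0 <= q a -> q a < x a -> 0 < grad q x a.
Proof.
have d0 := delta_gt0; move=> q0 lt.
by rewrite mulr_gt0 ?wat_gt0 // ln_gt0 // ltr_pdivlMr; lra.
Qed.

Lemma grad_lt0 q x a : 0 <= x a -> x a < q a -> grad q x a < 0.
Proof.
have d0 := delta_gt0; move=> x0 lt.
rewrite pmulr_rlt0 ?wat_gt0 // ln_lt0 // divr_gt0 /=; try lra.
by rewrite ltr_pdivrMr; lra.
Qed.

Lemma step_feasible r q x : step_to r q x -> feasible r x.
Proof. by case=> /polyhedronE. Qed.

Lemma step_ge0 r q x : step_to r q x -> forall a, 0 <= x a.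
Proof.
by move=> /step_feasible[box _ _] a; case/andP: (box a) => /(le_trans (lower_ge0 a)).
Qed.

(** Lowering [a] alone is then a feasible direction, so the gradient at [a] is not positive. At its
    own vertex, lowering an atom only relaxes the inequalities. *)
Lemma step_no_decrease r q x a : (forall a, 0 <= q a) -> step_to r q x ->
  lower a < x a ->
  (forall u S, ~~ is_leaf u -> S \subset chi u ->
     prefix_sum x u #|S| = \sum_(c in S) x c -> a \notin S) ->
  x a <= q a.
Proof.
move=> q0 xP la Ha; rewrite leNgt; apply/negP => /(grad_gt0 (q0 a)) g0.
have := @tangent r q x (fun c => - (c == a)%:R) q0 xP.
rewrite (eq_bigr (fun c => - ((c == a)%:R * grad q x c))); last first.
  by move=> c _; rewrite mulrN mulrC.
rewrite sumrN (sum_indicM (pred1 a)) big_pred1_eq => H.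
suff : 0 <= - grad q x a by lra.
apply: H.
- by move=> c E; case: eqP => [ca|_]; [rewrite -ca E ltxx in la | rewrite oppr0].
- by move=> c _; rewrite oppr_le0.
- by rewrite oppr_le0.
- move=> u S nu su /(Ha _ _ nu su) aS; rewrite /prefix_sum !sumrN lerN2 !sum_indic.
  by rewrite (negPf aS).
Qed.

(** Raising [b] alone is feasible: it is not the request atom, and no tight set at its vertex is
    large enough for the prefix to contain [b]. *)
Lemma step_no_increase r q x b : (forall a, 0 <= q a) -> step_to r q x ->
  ~~ is_leaf (tag b) -> x b < 2 ->
  (forall S, S \subset chi (tag b) ->
     prefix_sum x (tag b) #|S| = \sum_(c in S) x c -> (#|S| <= idx b)%N) ->
  q b <= x b.
Proof.
move=> q0 xP nb xb2 Hb; rewrite leNgt; apply/negP => /(grad_lt0 (step_ge0 xP b)) g0.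
have := @tangent r q x (fun c => (c == b)%:R) q0 xP.
rewrite (eq_bigr (fun c => (c == b)%:R * grad q x c)); last first.
  by move=> c _; rewrite mulrC.
rewrite (sum_indicM (pred1 b)) big_pred1_eq => H.
suff : 0 <= grad q x b by lra.
apply: H.
- by move=> c E.
- by move=> c E; case: eqP => [cb|//]; rewrite -cb E ltxx in xb2.
- by move=> _; case: eqP => // E; rewrite -E /= (valP r) in nb.
- move=> u S nu su E; rewrite /prefix_sum !sum_indic ler_nat.
  have [bu|//] := eqVneq (tag b) u; rewrite -bu in su E.
  by rewrite ltnNge (Hb _ su E).
Qed.

(** Exchange argument: if the order broke, moving mass from [a] to [b] would be feasible, yet its
    pairing with the gradient is negative because [x b < x a] and [q a <= q b]. *)
Lemma step_mono r q x : (forall a, 0 <= q a) -> step_to r q x ->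
  (forall a b, tag a = tag b -> (idx a <= idx b)%N -> q a <= q b) ->
  forall a b, tag a = tag b -> (idx a <= idx b)%N -> x a <= x b.
Proof.
move=> q0 xP qmono a b tab; rewrite leq_eqVlt => /orP[/eqP ab|ab].
  by rewrite (atom_inj tab ab).
have [box _ dom] := step_feasible xP.
rewrite leNgt; apply/negP => xba.
have neq : b != a by apply: contraTneq ab => ->; rewrite ltnn.
have := @tangent r q x (fun c => (c == b)%:R - (c == a)%:R) q0 xP.
rewrite (eq_bigr (fun c =>
  (c == b)%:R * grad q x c - (c == a)%:R * grad q x c)); last first.
  by move=> c _; ring.
rewrite sumrB (sum_indicM (pred1 b)) (sum_indicM (pred1 a)) !big_pred1_eq => H.
have gab : grad q x b < grad q x a.
  rewrite /div_grad /wat tab ltr_pM2l ?w_gt0 //.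
  have x0 := step_ge0 xP; have qa0 := q0 a; have qb0 := q0 b.
  have xa0 := x0 a; have xb0 := x0 b.
  have qab := qmono _ _ tab (ltnW ab).
  have d0 := delta_gt0; rewrite ltr_ln ?posrE ?divr_gt0 //; try lra.
  apply: (@lt_le_trans _ _ ((x a + delta) / (q b + delta))).
    by rewrite ltr_pM2r ?invr_gt0; lra.
  by rewrite ler_pM2l ?lef_pV2 ?posrE; lra.
suff : 0 <= grad q x b - grad q x a by lra.
apply: H.
- move=> c E; have [ca|_] := eqVneq c a; last by rewrite subr0.
  have /andP[lb _] := box b; have := lower_mono tab (ltnW ab); rewrite ca in E.
  by move: lb xba; rewrite E; lra.
- move=> c E; have [cb|_] := eqVneq c b; last by rewrite sub0r oppr_le0.
  have /andP[_ la] := box a; rewrite cb in E; lra.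
- move=> _; have [cb|_] := eqVneq (leaf_atom r) b; last by rewrite sub0r oppr_le0.
  by move: ab; rewrite -cb.
move=> u S nu su E; rewrite /prefix_sum !sumrB !sum_indic.
(* As [a] precedes [b], the prefix sum of the direction is never positive, so only a set containing
   [a] but not [b] could be violated. *)
have [aS|aS] := boolP (a \in S); last first.
  have pre : ((tag b == u) && (idx b < #|S|) <= (tag a == u) && (idx a < #|S|))%N.
    rewrite tab; case: (tag b == u) => //=.
    by case: (ltnP (idx b) #|S|) => // bS; rewrite (ltn_trans ab bS).
  rewrite subr0; apply: (@le_trans _ _ 0); last by [].
  by rewrite subr_le0 ler_nat.
have [bS|bS] := boolP (b \in S).
  rewrite subrr subr_le0 ler_nat tab; case: (tag b == u) => //=.
  by case: (ltnP (idx b) #|S|) => // bS'; rewrite (ltn_trans ab bS').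
(* Swapping [a] for [b] in a tight set keeps its size and lowers its sum, against domination. *)
pose S' := b |: (S :\ a).
have bS' : b \notin S :\ a by rewrite !inE (negPf bS) andbF.
have cS' : #|S'| = #|S| by rewrite cardsU1 bS' (cardsD1 a S) aS.
have sS' : S' \subset chi u.
  apply/fintype.subsetP => c; rewrite !inE => /orP[/eqP->|/andP[_ cS]].
    by rewrite -tab; have := fintype.subsetP su _ aS; rewrite inE.
  by have := fintype.subsetP su _ cS; rewrite inE.
have := dom _ _ nu sS'; rewrite cS' E big_setU1 //= (big_setD1 a aS) /=.
move: xba; lra.
Qed.

(** The invariant of the algorithm. The last clause makes the inequality for [S = chi u] an
    equality; with the exact root values it fixes the leaf sum. *)
Definition balanced q : Prop :=
  [/\ forall a, lower a <= q a <= 1,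
      forall a, tag a = root T -> q a = (h <= idx a)%N%:R,
      dominated q,
      forall a b, tag a = tag b -> (idx a <= idx b)%N -> q a <= q b
    & forall u, ~~ is_leaf u ->
        \sum_(a | tag a == u) q a = \sum_(a in chi u) q a].

Lemma balanced_ge0 q : balanced q -> forall a, 0 <= q a.
Proof. by case=> box _ _ _ _ a; case/andP: (box a) => /(le_trans (lower_ge0 a)). Qed.

(** Root atoms belong to no [chi u], so one lying above its lower bound would be at most [q a],
    which equals that bound. *)
Lemma step_root r q x a : balanced q -> step_to r q x ->
  tag a = root T -> x a = (h <= idx a)%N%:R.
Proof.
move=> qI xP ar; have q0 := balanced_ge0 qI; case: qI => _ /(_ a ar) qr _ _ _.
have [box _ _] := step_feasible xP.
have la : lower a = (h <= idx a)%N%:R by rewrite /lower ar (negPf root_nonleaf) eqxx.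
apply/eqP; rewrite eq_le -{2}la; case/andP: (box a) => -> _; rewrite andbT leNgt.
apply/negP => lt; have : x a <= q a.
  apply: step_no_decrease xP _ _ => //; first by rewrite la.
  move=> u S nu su _; apply/negP => /(fintype.subsetP su).
  by rewrite inE /is_child ar eqxx.
by rewrite qr leNgt lt.
Qed.

(** Split both sides along the largest tight set [U]. Child atoms outside [U] did not increase and
    atoms of [u] from index [#|U|] on did not decrease, so strict slack would contradict the equal
    totals of [q]. *)
Lemma step_total r q x u : balanced q -> step_to r q x -> ~~ is_leaf u ->
  \sum_(a | tag a == u) x a = \sum_(a in chi u) x a.
Proof.
move=> qI xP nu; have q0 := balanced_ge0 qI.
case: qI => qbox _ qdom qmono qtot.
have [box _ dom] := step_feasible xP.
have xmono := step_mono q0 xP qmono.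
have cchi := card_chi nu.
have full z : prefix_sum z u #|chi u| = \sum_(a | tag a == u) z a.
  by rewrite prefix_sum_all // cchi.
apply/eqP; rewrite eq_le -{1}full dom //= leNgt; apply/negP => lt.
pose tight S := (S \subset chi u) && (prefix_sum x u #|S| == \sum_(a in S) x a).
have t0 : tight finset.set0.
  rewrite /tight finset.sub0set cards0 big_set0; apply/eqP; apply: big1 => a.
  by rewrite ltn0 andbF.
case: (arg_maxnP (fun S : {set atom T} => #|S|) t0) => U /andP[sU /eqP tU] maxU.
(* A supermodular left side against a modular right side makes tight sets closed under union, so the
   largest one contains them all. *)
have subU S : S \subset chi u ->
    prefix_sum x u #|S| = \sum_(a in S) x a -> S \subset U.
  move=> sS tS; have sSU : S :|: U \subset chi u by rewrite finset.subUset sS sU.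
  have sSI : S :&: U \subset chi u.
    by apply: fintype.subset_trans (finset.subsetIl _ _) sS.
  have tSU : tight (S :|: U).
    rewrite /tight sSU /= eq_le dom //=.
    have := prefix_sum_supermodular nu xmono sS sU; have := dom _ _ nu sSI.
    have E : \sum_(a in S :|: U) x a + \sum_(a in S :&: U) x a =
             \sum_(a in S) x a + \sum_(a in U) x a.
      have indic (V : {set atom T}) :
          \sum_(a in V) x a = \sum_a (a \in V)%:R * x a.
        by rewrite (sum_indicM (mem V)).
      rewrite !indic -!big_split /=; apply: eq_bigr => a _.
      by rewrite !inE; case: (a \in S); case: (a \in U); ring.
    move: E; rewrite tS tU; lra.
  have /eqP -> : U == S :|: U by rewrite eqEcard finset.subsetUr; apply: maxU.
  exact: finset.subsetUl.
have splitU (z : atom T -> R) :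
    \sum_(a in chi u) z a = \sum_(a in U) z a + \sum_(a in chi u :\: U) z a.
  by rewrite (big_setID U) /= (finset.setIidPr sU).
have decr : \sum_(a in chi u :\: U) x a <= \sum_(a in chi u :\: U) q a.
  apply: ler_sum => a; rewrite inE => /andP[aU aC].
  have /andP[la _] := box a; have /andP[lqa _] := qbox a.
  move: la; rewrite le_eqVlt => /orP[/eqP<-//|la].
  apply: step_no_decrease xP la _ => // u' S nu' su' tS; apply: contra aU => aS.
  have uu' : u' = u.
    have := fintype.subsetP su' _ aS; move: aC.
    by rewrite !inE => /andP[_ /eqP<-] /andP[_ /eqP<-].
  rewrite uu' in su' tS; exact: fintype.subsetP (subU _ su' tS) _ aS.
pose rest (z : atom T -> R) := \sum_(a | (tag a == u) && (#|U| <= idx a)%N) z a.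
have splitP (z : atom T -> R) :
    \sum_(a | tag a == u) z a = prefix_sum z u #|U| + rest z.
  rewrite /rest (bigID (fun a => (idx a < #|U|)%N)) /=; congr (_ + _).
  by apply: eq_bigl => a; rewrite -leqNgt.
have : rest x < rest q.
  have := qdom _ _ nu sU; have := qtot _ nu; move: lt decr.
  by rewrite !splitP !splitU tU; lra.
apply/negP; rewrite -leNgt; apply: ler_sum => b /andP[/eqP bu Ub].
rewrite leNgt; apply/negP => xqb; have /andP[_ qb1] := qbox b.
have : q b <= x b; last by rewrite leNgt xqb.
apply: step_no_increase xP _ _ _ => //; rewrite ?bu //; first by lra.
by move=> S sS tS; apply: leq_trans Ub; apply: subset_leq_card; apply: subU.
Qed.

(** Downwards from the root: subtracting the inequality for [chi u :\ a] from the equality for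
    [chi u] bounds [x a] by the last atom of the parent. *)
Lemma step_le1 r q x : balanced q -> step_to r q x -> forall a, x a <= 1.
Proof.
move=> qI xP a; have [box _ dom] := step_feasible xP.
elim: {a}(depth (tag a)) {-2}a (erefl (depth (tag a))) => [|d IH] a da.
  rewrite (step_root qI xP) ?lern1 ?leq_b1 //.
  by apply/eqP; rewrite -depth_eq0 da.
pose u := parent (tag a).
have au : is_child (tag a) u by rewrite /is_child eqxx andbT -depth_eq0 da.
have nu := child_nonleaf au.
have aC : a \in chi u by rewrite inE.
have cC : #|chi u| = #|chi u :\ a|.+1 by rewrite (cardsD1 a) aC.
have lt : (#|chi u :\ a| < #|leaves u|)%N by rewrite -card_chi // cC.
have := dom u (chi u :\ a) nu (finset.subD1set _ _).
have := step_total qI xP nu; rewrite (big_setD1 a aC) /=.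
rewrite -(@prefix_sum_all _ _ _ _ #|chi u :\ a|.+1) ?prefix_sumS -?cC ?card_chi //.
have := IH (mkatom (Ordinal lt)); rewrite depth_parent da => /(_ erefl).
lra.
Qed.

Lemma step_balanced r q x : balanced q -> step_to r q x -> balanced x.
Proof.
move=> qI xP; have q0 := balanced_ge0 qI; have [box _ dom] := step_feasible xP.
split=> //.
- by move=> a; case/andP: (box a) => -> _; rewrite (step_le1 qI xP).
- by move=> a; apply: step_root qI xP.
- by case: qI => _ _ _ qmono _; apply: step_mono q0 xP qmono.
- by move=> u; apply: step_total qI xP.
Qed.

Lemma step_request r q x : step_to r q x -> x (leaf_atom r) = delta.
Proof.
move=> xP; have [box req _] := step_feasible xP.
apply/eqP; rewrite eq_le req; case/andP: (box (leaf_atom r)) => + _.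
by rewrite /lower /= (valP r).
Qed.

End Invariant.

(** * Prefix sums of explicit vectors *)

Section PrefixValues.
Variables (R : realDomainType) (T : rtree).
Implicit Types (u : T) (a : atom T) (x : atom T -> R).

Lemma prefix_sum_values x u (F : nat -> R) n : (n <= #|leaves u|)%N ->
  (forall a, tag a = u -> x a = F (idx a)) ->
  prefix_sum x u n = \sum_(i < n) F i.
Proof.
move=> + xF; elim: n => [_|n IH lt].
  by rewrite big_ord0; apply: big1 => a; rewrite ltn0 andbF.
by rewrite (prefix_sumS _ lt) big_ord_recr /= IH ?(ltnW lt) // xF.
Qed.

Lemma prefix_sum_cst u (c : R) n : (n <= #|leaves u|)%N ->
  prefix_sum (fun=> c) u n = c * n%:R.
Proof.
move=> le; rewrite (@prefix_sum_values _ _ (fun=> c)) // sumr_const card_ord.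
by rewrite mulr_natr.
Qed.

Lemma prefix_sum_le x y u n : (forall a, tag a = u -> x a <= y a) ->
  prefix_sum x u n <= prefix_sum y u n.
Proof. by move=> H; apply: ler_sum => a /andP[/eqP /H]. Qed.

Lemma prefix_sum_affine x y u (c d e : R) n : (n <= #|leaves u|)%N ->
  prefix_sum (fun a => c * y a + d * x a + e) u n =
  c * prefix_sum y u n + d * prefix_sum x u n + e * n%:R.
Proof.
by move=> le; rewrite -(prefix_sum_cst _ le) /prefix_sum !mulr_sumr -!big_split.
Qed.

Lemma sum_ord_ge (m al : nat) :
  \sum_(j < m) (al <= j)%N%:R = (m - al)%:R :> R.
Proof.
elim: m => [|m IH]; first by rewrite big_ord0.
rewrite big_ord_recr /= IH -natrD; congr _%:R.
by case: (leqP al m) => le /=; lia.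
Qed.

Lemma sum_ord_lt (m al : nat) : (\sum_(j < m) (j < al) = minn m al)%N.
Proof.
elim: m => [|m IH]; first by rewrite big_ord0 min0n.
by rewrite big_ord_recr /= IH; case: (ltnP m al); lia.
Qed.

End PrefixValues.

(** * Integral configurations *)

Section AntiserverFacts.
Variables (R : realType) (T : rtree) (D : nat) (h : nat).
Hypothesis leavesD : leaves_at_depth T D.
Implicit Types (u : T) (x y : {ffun atom T -> R}) (A B : {set leaf T}).

Lemma antiserverE x : antiserver h x <->
  [/\ forall a, 0 <= x a <= 1,
      forall a, tag a = root T -> (h <= idx a)%N%:R <= x a & dominated x].
Proof.
split=> -[box rt dom]; split=> //.
- by case=> u j /= E; subst u; apply: rt.
- move=> u S nu su; rewrite /prefix_sum (sum_atoms_at u (fun n => (n < #|S|)%N)).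
  exact: dom.
- by move=> j; apply: (rt (mkatom j)).
- move=> u nu S su; rewrite -(sum_atoms_at u (fun n => (n < #|S|)%N)).
  exact: dom.
Qed.

Lemma config_vecE A a : config_vec R A a = (#|A :&: leaves (tag a)| <= idx a)%N%:R.
Proof. by rewrite ffunE /idx ltnNge; case: ifP => /= [/negPf->|/negbFE->]. Qed.

Lemma config_vec_leaf A l : config_vec R A (leaf_atom l) = (l \notin A)%:R.
Proof.
rewrite config_vecE /= leaves_leaf /idx /= leqn0 cards_eq0.
congr _%:R; congr nat_of_bool; apply/eqP/idP => [E|lA].
  by apply/negP => lA; have := finset.in_set0 l; rewrite -E !inE lA eqxx.
apply/setP => l'; rewrite !inE; apply/negP => /andP[+ /eqP E].
by rewrite E (negPf lA).
Qed.

Lemma sum_config_vec A u n : (n <= #|leaves u|)%N ->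
  prefix_sum (config_vec R A) u n = (n - #|A :&: leaves u|)%:R.
Proof.
move=> le.
rewrite (@prefix_sum_values _ _ _ _ (fun j => (#|A :&: leaves u| <= j)%N%:R)) //.
  exact: sum_ord_ge.
by move=> a E; rewrite config_vecE E.
Qed.

(** The sum over [S] is [#|S|] minus its number of zero atoms, and [chi u] has only
    [#|A :&: leaves u|] of those; the prefix sum is the truncated difference of these numbers. *)
Lemma antiserver_config A : (#|A| <= h)%N -> antiserver h (config_vec R A).
Proof.
move=> Ah; apply/antiserverE; split.
- by move=> a; rewrite config_vecE ler0n lern1 leq_b1.
- move=> a _; rewrite config_vecE ler_nat.
  have cA : (#|A :&: leaves (tag a)| <= h)%N.
    exact: leq_trans (subset_leq_card (finset.subsetIl _ _)) Ah.
  by case: (leqP h (idx a)) => // ha; rewrite (leq_trans cA ha).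
move=> u S nu su.
have cS : (#|S| <= #|leaves u|)%N by rewrite -card_chi // subset_leq_card.
rewrite sum_config_vec //.
have E : \sum_(a in S) config_vec R A a +
    \sum_(a in S) (idx a < #|A :&: leaves (tag a)|)%N%:R = #|S|%:R.
  rewrite -big_split /= -sumr_const; apply: eq_bigr => a _.
  by rewrite config_vecE ltnNge; case: leqP => _; rewrite ?addr0 ?add0r.
have L : \sum_(a in S) (idx a < #|A :&: leaves (tag a)|)%N%:R <=
    #|A :&: leaves u|%:R :> R.
  apply: (@le_trans _ _
    (\sum_(a in chi u) (idx a < #|A :&: leaves (tag a)|)%N%:R)).
    rewrite [leRHS](big_setID S) /= (finset.setIidPr su) lerDl.
    by apply: sumr_ge0 => a _; apply: ler0n.
  rewrite -(card_children _ nu) natr_sum.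
  rewrite [leLHS](eq_bigl (fun a => is_child (tag a) u && true)); last first.
    by move=> a; rewrite inE andbT.
  rewrite (sum_atoms (fun v => is_child v u) xpredT) /=; apply: ler_sum => v _.
  by rewrite -natr_sum ler_nat sum_ord_lt geq_minr.
case: (leqP #|A :&: leaves u| #|S|) => le.
  by rewrite natrB //; lra.
rewrite (_ : (_ - _)%N = 0%N); last by apply/eqP; rewrite subn_eq0 ltnW.
by apply: sumr_ge0 => a _; rewrite config_vecE.
Qed.

Lemma tree_normE (w : T -> R) x :
  tree_norm w x = \sum_a wat w a * `|x a|.
Proof.
transitivity (\sum_(a : atom T | true && true) wat w a * `|x a|); last by [].
rewrite (sum_atoms xpredT xpredT) /=; apply: eq_bigr => u _.
by rewrite mulr_sumr.
Qed.

Lemma leaf_restrE x l : leaf_restr x l = x (leaf_atom l).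
Proof. exact: ffunE. Qed.

Lemma ffun_subE x y a : (x - y) a = x a - y a.
Proof. by rewrite !ffunE. Qed.

(** At a fixed vertex both columns are 0-1 thresholds, so their differences have one sign and the
    sum of absolute values is the absolute value of the sum. *)
Lemma tree_norm_config (w : T -> R) A B :
  tree_norm w (config_vec R A - config_vec R B) =
  leaf_dist w (leaf_restr (config_vec R A)) (leaf_restr (config_vec R B)).
Proof.
apply: eq_bigr => u _; congr (_ * _).
have leafsum C : \sum_(l in leaves u) leaf_restr (config_vec R C) l =
    #|leaves u|%:R - #|C :&: leaves u|%:R.
  apply/eqP; rewrite eq_sym subr_eq; apply/eqP.
  rewrite -[#|leaves u|]sum1_card -[#|C :&: leaves u|]sum1_card !natr_sum.
  rewrite [X in _ + X](eq_bigl (fun l => (l \in leaves u) && (l \in C))); last first.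
    by move=> l; rewrite inE andbC.
  rewrite big_mkcondr -big_split /=; apply: eq_bigr => l _.
  by rewrite ffunE config_vec_leaf; case: (l \in C); rewrite ?addr0 ?add0r.
rewrite !leafsum.
have colsum C : \sum_(j < #|leaves u|) config_vec R C (mkatom j) =
    #|leaves u|%:R - #|C :&: leaves u|%:R.
  transitivity (prefix_sum (config_vec R C) u #|leaves u|).
    rewrite /prefix_sum (sum_atoms_at u (fun n => (n < #|leaves u|)%N)).
    by apply: eq_bigl => j; rewrite ltn_ord.
  rewrite sum_config_vec // natrB // subset_leq_card // finset.subsetIr //.
rewrite -!colsum -sumrB.
have mono C C' : (#|C :&: leaves u| <= #|C' :&: leaves u|)%N ->
    forall j : 'I_#|leaves u|, config_vec R C' (mkatom j) <= config_vec R C (mkatom j).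
  move=> le j; rewrite !config_vecE ler_nat /=.
  by case: (leqP #|C' :&: leaves u| (idx _)) => // /(leq_trans le) ->.
case: (leqP #|A :&: leaves u| #|B :&: leaves u|) => [le|/ltnW le].
  have m := mono _ _ le; rewrite ger0_norm; last first.
    by apply: sumr_ge0 => j _; rewrite subr_ge0.
  by apply: eq_bigr => j _; rewrite ffun_subE ger0_norm // subr_ge0.
have m := mono _ _ le; rewrite ler0_norm; last first.
  by apply: sumr_le0 => j _; rewrite subr_le0.
by rewrite -sumrN; apply: eq_bigr => j _; rewrite ffun_subE ler0_norm // subr_le0.
Qed.

Lemma sum_ge_root x : dominated x ->
  \sum_(a | tag a == root T) x a <= \sum_(l : leaf T) x (leaf_atom l).
Proof.
move=> dom; apply: (leaf_sum_ge leavesD) => u nu.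
by rewrite -(@prefix_sum_all _ _ _ _ #|chi u|) ?card_chi // -card_chi // dom.
Qed.

Lemma sum_root_indic (x : atom T -> R) :
  (forall a, tag a = root T -> x a = (h <= idx a)%N%:R) ->
  \sum_(a | tag a == root T) x a = (nleaves T - h)%:R.
Proof.
move=> H; rewrite -(@prefix_sum_all _ _ _ _ (nleaves T)) ?card_leaves_root //.
rewrite (@prefix_sum_values _ _ _ _ (fun j => (h <= j)%N%:R)) ?card_leaves_root //.
exact: sum_ord_ge.
Qed.

Definition servers x : {set leaf T} := [set l | x (leaf_atom l) == 0].

Lemma leaf_restr_servers x : integral x ->
  leaf_restr (config_vec R (servers x)) = leaf_restr x.
Proof.
move=> xi; apply/ffunP => l; rewrite !leaf_restrE config_vec_leaf inE.
by case: (xi (leaf_atom l)) => ->; rewrite ?eqxx ?oner_eq0.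
Qed.

(** The root atoms sum to at least [n - h], hence so do the leaf atoms, whose sum counts the leaves
    without server. *)
Lemma card_servers x : (h <= nleaves T)%N -> antiserver h x -> integral x ->
  (#|servers x| <= h)%N.
Proof.
move=> hn /antiserverE[box rt dom] xi.
have := sum_ge_root dom.
have : (nleaves T - h)%:R <= \sum_(a | tag a == root T) x a.
  rewrite -(@sum_root_indic (fun a => (h <= idx a)%N%:R)) //.
  by apply: ler_sum => a /eqP; apply: rt.
move=> /le_trans /[apply].
rewrite (eq_bigr (fun l => (l \notin servers x)%:R)); last first.
  by move=> l _; rewrite -leaf_restrE -leaf_restr_servers // leaf_restrE config_vec_leaf.
rewrite -natr_sum ler_nat.
have -> : (\sum_l (l \notin servers x) = #|~: servers x|)%N.
  rewrite -sum1_card [RHS]big_mkcond; apply: eq_bigr => l _.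
  by rewrite finset.in_setC; case: (l \in _).
have cC : (#|servers x| + #|~: servers x| = nleaves T)%N := cardsC _.
by lia.
Qed.

End AntiserverFacts.

(** * Cost of the projection step *)

Section Cost.
Variables (R : realType) (T : rtree) (D : nat) (w : T -> R) (h : nat).
Variable delta : R.
Hypotheses (leavesD : leaves_at_depth T D) (D_gt0 : (0 < D)%N).
Hypotheses (w_gt0 : forall u, 0 < w u) (delta_gt0 : 0 < delta).
Implicit Types (u : T) (a : atom T) (q x y : atom T -> R) (r : leaf T).

Local Notation wt := (wat w).
Local Notation grad := (div_grad wt delta).
Local Notation inv := (balanced h delta).
Local Notation step := (step_to w h delta).

Definition adversary y : Prop :=
  [/\ forall a, 0 <= y a <= 1,
      forall a, tag a = root T -> (h <= idx a)%N%:R <= y a & dominated y].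

(* [2 D - depth] drops by one from a vertex to its children: this pays for
   lowering any set of atoms of the children, here those that increased. *)
Definition test_dir q x y a : R :=
  D%:R * (y a + delta) -
  2^-1 * (x a + delta) * (2 * D%:R - (depth (tag a))%:R + (q a < x a)%R%:R).

Lemma test_dir_prefix q x y u (S : {set atom T}) :
  adversary y -> (forall a, 0 <= x a) ->
  ~~ is_leaf u -> S \subset chi u ->
  prefix_sum x u #|S| = \sum_(a in S) x a ->
  prefix_sum (test_dir q x y) u #|S| <= \sum_(a in S) test_dir q x y a.
Proof.
move=> [_ _ ydom] x0 nu su tS; have d0 := delta_gt0.
have cS : (#|S| <= #|leaves u|)%N by rewrite -card_chi // subset_leq_card.
(* [K] freezes the factor of [x a + delta] at the depth of [u]. The direction lies below [t] on
   atoms of [u] and above [t] on those of the children; [t] satisfies the inequality since [x] is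
   tight and [y] dominated. *)
pose K : R := 2^-1 * (2 * D%:R - (depth u)%:R).
pose t a : R := D%:R * y a + (- K) * x a + (D%:R - K) * delta.
apply: (@le_trans _ _ (prefix_sum t u #|S|)).
  apply: prefix_sum_le => a au; rewrite /test_dir /t /K au.
  have xa0 := x0 a; have b0 : 0 <= (q a < x a)%R%:R :> R by [].
  have : 0 <= (x a + delta) * (q a < x a)%R%:R by rewrite mulr_ge0 //; lra.
  by nra.
apply: (@le_trans _ _ (\sum_(a in S) t a)); last first.
  apply: ler_sum => a /(fintype.subsetP su); rewrite inE => /depth_child dE.
  rewrite /test_dir /t /K dE -(natr1 (depth u)).
  have xa0 := x0 a; have b1 : (q a < x a)%R%:R <= 1 :> R by rewrite lern1 leq_b1.
  have : 0 <= (x a + delta) * (1 - (q a < x a)%R%:R).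
    by rewrite mulr_ge0 ?subr_ge0 //; lra.
  by nra.
rewrite prefix_sum_affine // !big_split /= sumr_const -!mulr_sumr tS mulr_natr.
by rewrite !lerD2r ler_wpM2l // ydom.
Qed.

(** A leaf at [delta] has not increased, so the direction is [D * y a]; a root atom has not moved
    and gives [D * (y a - x a)]; elsewhere [x a = 0] and the depth, at least 1, absorbs the
    indicator. *)
Lemma test_dir_lower q x y a : adversary y -> inv q -> inv x ->
  x a = lower h delta a -> 0 <= test_dir q x y a.
Proof.
move=> [ybox yroot _] [qbox qroot _ _ _] [xbox xroot _ _ _] E.
have d0 := delta_gt0; have D1 : 1 <= D%:R :> R by rewrite ler1n.
have /andP[y0 _] := ybox a.
rewrite /test_dir; move: E; rewrite /lower.
case: ifP => [al E|nl].
  have da : depth (tag a) = D by apply/eqP; rewrite -(is_leaf_depth leavesD).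
  have /andP[+ _] := qbox a; rewrite /lower al -E leNgt => /negPf->.
  by rewrite E da addr0; nra.
case: ifP => [/eqP ar E|/negbT nr E].
  have yr := yroot _ ar.
  by rewrite qroot // xroot // ltxx ar depth_root subr0 addr0; nra.
have d1 : 1 <= (depth (tag a))%:R :> R by rewrite ler1n lt0n depth_eq0.
have b1 : (q a < x a)%R%:R <= 1 :> R by rewrite lern1 leq_b1.
set b := (q a < x a)%R%:R in b1 *; set d := (depth _)%:R in d1 *.
rewrite E add0r.
have : 0 <= delta * (d - b) by rewrite mulr_ge0 //; lra.
have : 0 <= D%:R * y a by rewrite mulr_ge0.
by nra.
Qed.

(** The shift equals the leaf bound [delta], so at depth [D] the two terms cancel exactly. *)
Lemma test_dir_request q x y r : inv q -> step r q x -> y (leaf_atom r) = 0 ->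
  test_dir q x y (leaf_atom r) = 0.
Proof.
move=> [qbox _ _ _ _] xP y0.
have xr := step_request xP; rewrite /test_dir y0 xr.
have /andP[+ _] := qbox (leaf_atom r).
rewrite /lower /= (valP r) leNgt => /negPf->; rewrite (leavesD r) addr0.
by field.
Qed.

(** This is [ln z >= 1 - 1 / z] at [z = (x a + delta) / (q a + delta)]. *)
Lemma grad_move_le q x a : 0 <= q a -> 0 <= x a ->
  wt a * (x a - q a) <= grad q x a * (x a + delta).
Proof.
move=> q0 x0; have d0 := delta_gt0.
have qd : 0 < q a + delta by lra.
have xd : 0 < x a + delta by lra.
rewrite /div_grad -mulrA ler_pM2l ?w_gt0 //.
have := ln_le_subr1 (divr_gt0 qd xd).
rewrite !ln_div ?posrE // => H.
have : (ln (q a + delta) - ln (x a + delta)) * (x a + delta) <=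
       ((q a + delta) / (x a + delta) - 1) * (x a + delta) by rewrite ler_pM2r.
rewrite (_ : ((q a + delta) / _ - 1) * _ = q a - x a); last by field; lra.
lra.
Qed.

(** The coefficient of the signed moves, whose sum telescopes over time. *)
Definition level_weight a : R := 2 * (2 * D%:R - (depth (tag a))%:R) + 1.

Lemma level_weight_bounds a : 1 <= level_weight a <= 4 * D%:R + 1.
Proof.
rewrite /level_weight.
have : (depth (tag a))%:R <= D%:R :> R by rewrite ler_nat (depth_atom leavesD).
have : 0 <= (depth (tag a))%:R :> R by [].
have : 0 <= D%:R :> R by [].
lra.
Qed.

Lemma step_cost r q x y : inv q -> step r q x -> adversary y ->
  y (leaf_atom r) = 0 ->
  \sum_a wt a * `|x a - q a| <=
  4 * D%:R * \sum_a grad q x a * (y a + delta) -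
  \sum_a wt a * level_weight a * (x a - q a).
Proof.
move=> qI xP yA y0; have xI := step_balanced leavesD D_gt0 w_gt0 delta_gt0 qI xP.
have q0 := balanced_ge0 delta_gt0 qI; have x0 := balanced_ge0 delta_gt0 xI.
have x1 a : x a <= 1 by case: xI => box _ _ _ _; case/andP: (box a).
have key : 0 <= \sum_a grad q x a * test_dir q x y a.
  apply: (tangent w_gt0 delta_gt0 q0 xP).
  - by move=> a; apply: test_dir_lower.
  - by move=> a E; have := x1 a; rewrite E; lra.
  - by rewrite (test_dir_request qI xP y0).
  - by move=> u S; apply: test_dir_prefix.
suff : 4 * \sum_a grad q x a * test_dir q x y a <=
    4 * D%:R * (\sum_a grad q x a * (y a + delta)) -
    \sum_a wt a * level_weight a * (x a - q a) - \sum_a wt a * `|x a - q a| by lra.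
rewrite !mulr_sumr -!sumrB; apply: ler_sum => a _.
have M := grad_move_le (q0 a) (x0 a).
have /andP[L1 _] := level_weight_bounds a; rewrite /level_weight in L1 *.
have W := w_gt0 (tag a); rewrite -/(wt a) in W.
set g := grad q x a in M *; rewrite /test_dir.
set d := (depth _)%:R in L1 *; set n := D%:R in L1 *.
have dn : 0 <= 2 * n - d.
  have : d <= n by rewrite ler_nat (depth_atom leavesD).
  have : 0 <= n by []. lra.
have M1 : (wt a * (x a - q a)) * (2 * n - d) <= (g * (x a + delta)) * (2 * n - d).
  by rewrite ler_wpM2r.
(* Four times the factor of [x a + delta] is [level_weight a + 1] on a rise and [level_weight a - 1]
   otherwise; the difference from [level_weight a] yields the absolute move. *)
case: ltP => [lt|le] /=.
  by rewrite gtr0_norm ?subr_gt0 //; nra.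
by rewrite ler0_norm ?subr_le0 //; nra.
Qed.

Definition potential y x : R :=
  \sum_a wt a * (y a + delta) * (ln (1 + delta) - ln (x a + delta)).

Lemma potential_step q x y : (forall a, 0 <= q a) -> (forall a, 0 <= x a) ->
  \sum_a grad q x a * (y a + delta) = potential y q - potential y x.
Proof.
move=> q0 x0; have d0 := delta_gt0; rewrite /potential -sumrB; apply: eq_bigr => a _.
have qd : 0 < q a + delta by have := q0 a; lra.
have xd : 0 < x a + delta by have := x0 a; lra.
by rewrite /div_grad ln_div ?posrE //; ring.
Qed.

(** The source of the factor [ln (1 + 1 / delta)]: the worst case is [t = 0]. *)
Lemma log_weight_bounds (t : R) : 0 <= t <= 1 ->
  0 <= ln (1 + delta) - ln (t + delta) <= ln (1 + delta^-1).
Proof.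
move=> /andP[t0 t1]; have d0 := delta_gt0.
have -> : 1 + delta^-1 = (1 + delta) / delta by field; lra.
rewrite ln_div ?posrE; try lra.
by rewrite subr_ge0 lerD2l lerN2 !ler_ln ?posrE; lra.
Qed.

Lemma potential_ge0 y x : (forall a, 0 <= y a) -> (forall a, 0 <= x a <= 1) ->
  0 <= potential y x.
Proof.
move=> y0 x01; have d0 := delta_gt0; apply: sumr_ge0 => a _.
have /andP[l0 _] := log_weight_bounds (x01 a).
by rewrite mulr_ge0 // mulr_ge0 ?ltW ?w_gt0 //; have := y0 a; lra.
Qed.

Lemma potential_le y x : (forall a, 0 <= y a <= 1) -> (forall a, 0 <= x a <= 1) ->
  potential y x <= \sum_a wt a * (1 + delta) * ln (1 + delta^-1).
Proof.
move=> y01 x01; have d0 := delta_gt0; apply: ler_sum => a _.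
have /andP[l0 l1] := log_weight_bounds (x01 a); have /andP[y0 y1] := y01 a.
have W : 0 <= wt a by rewrite ltW // w_gt0.
apply: ler_pM => //; first by rewrite mulr_ge0 //; lra.
by rewrite ler_wpM2l // lerD2r.
Qed.

Lemma potential_move y y' x : (forall a, 0 <= x a <= 1) ->
  potential y' x - potential y x <=
  ln (1 + delta^-1) * \sum_a wt a * `|y' a - y a|.
Proof.
move=> x01; rewrite /potential -sumrB mulr_sumr; apply: ler_sum => a _.
have /andP[l0 l1] := log_weight_bounds (x01 a).
have W : 0 <= wt a by rewrite ltW // w_gt0.
set L := ln (1 + delta) - _ in l0 l1 *.
rewrite (_ : _ - _ = wt a * ((y' a - y a) * L)); last by ring.
rewrite (mulrC (ln _)) -mulrA ler_wpM2l //.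
apply: (@le_trans _ _ (`|y' a - y a| * L)); first by rewrite ler_wpM2r // ler_norm.
by rewrite ler_wpM2l.
Qed.

Definition level_mass x : R := \sum_a wt a * level_weight a * x a.

Lemma run_cost (r : nat -> leaf T) (x y : nat -> atom T -> R) (T0 : nat) :
  (forall t, inv (x t)) -> (forall t, step (r t.+1) (x t) (x t.+1)) ->
  (forall t, (t <= T0)%N -> adversary (y t)) ->
  (forall t, (1 <= t <= T0)%N -> y t (leaf_atom (r t)) = 0) ->
  \sum_(1 <= t < T0.+1) (\sum_a wt a * `|x t a - x t.-1 a|) <=
  4 * (D%:R * ln (1 + delta^-1)) *
    (\sum_(1 <= t < T0.+1) \sum_a wt a * `|y t a - y t.-1 a|) +
  (4 * D%:R * (\sum_a wt a * (1 + delta) * ln (1 + delta^-1)) +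
   \sum_a wt a * (4 * D%:R + 1)).
Proof.
move=> xI xP yA yr.
have x01 t a : 0 <= x t a <= 1.
  rewrite (balanced_ge0 delta_gt0 (xI t)) /=.
  by case: (xI t) => box _ _ _ _; case/andP: (box a).
have y01 t : (t <= T0)%N -> forall a, 0 <= y t a <= 1 by case/yA.
have lm0 t : 0 <= level_mass (x t).
  apply: sumr_ge0 => a _; have /andP[L1 _] := level_weight_bounds a.
  have /andP[xa0 _] := x01 t a.
  by rewrite mulr_ge0 // mulr_ge0 ?ltW ?w_gt0 //; lra.
have lm1 : level_mass (x 0%N) <= \sum_a wt a * (4 * D%:R + 1).
  apply: ler_sum => a _; have /andP[L1 L2] := level_weight_bounds a.
  have /andP[xa0 xa1] := x01 0%N a.
  have W : 0 <= wt a by rewrite ltW // w_gt0.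
  rewrite -mulrA ler_wpM2l //.
  by apply: le_trans L2; rewrite ler_piMr //; lra.
(* Amortisation: cost plus [4 D] times the potential plus [level_mass] is paid for by the
   adversary's moves; the initial values go into the additive constant. *)
suff H n : (n <= T0)%N ->
    \sum_(1 <= t < n.+1) (\sum_a wt a * `|x t a - x t.-1 a|) +
    4 * D%:R * potential (y n) (x n) + level_mass (x n) <=
    4 * (D%:R * ln (1 + delta^-1)) *
      (\sum_(1 <= t < n.+1) \sum_a wt a * `|y t a - y t.-1 a|) +
    4 * D%:R * potential (y 0%N) (x 0%N) + level_mass (x 0%N).
  have := H _ (leqnn _); have := lm0 T0; have := lm1.
  have p0 : 0 <= 4 * D%:R * potential (y T0) (x T0).
    apply: mulr_ge0; first by rewrite mulr_ge0.
    apply: potential_ge0 => // a.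
    by case/andP: (y01 _ (leqnn _) a).
  have p1 : 4 * D%:R * potential (y 0%N) (x 0%N) <=
      4 * D%:R * (\sum_a wt a * (1 + delta) * ln (1 + delta^-1)).
    by rewrite ler_wpM2l ?mulr_ge0 // potential_le //; apply: y01.
  move: p0 p1; lra.
elim: n => [_|n IH nT]; first by rewrite !big_nil // ?big_geq // mulr0 !add0r.
have := IH (ltnW nT).
rewrite [in X in _ -> X]big_nat_recr //= [in X in _ -> _ <= X]big_nat_recr //=.
have := step_cost (xI n) (xP n) (yA _ nT) (yr n.+1 nT).
rewrite (potential_step (y n.+1) (balanced_ge0 delta_gt0 (xI n))
  (balanced_ge0 delta_gt0 (xI n.+1))).
have -> : \sum_a wt a * level_weight a * (x n.+1 a - x n a) =
    level_mass (x n.+1) - level_mass (x n).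
  by rewrite /level_mass -sumrB; apply: eq_bigr => a _; rewrite mulrBr.
(* The adversary moves first, at the old state [x n]; the step is then charged against [y n.+1]. *)
have := @potential_move (y n) (y n.+1) (x n) (x01 n).
rewrite -(@ler_pM2l _ (4 * D%:R)); last by rewrite mulr_gt0 // ltr0n.
lra.
Qed.

End Cost.

(** * Existence of the iterates *)

Section Existence.
Variables (R : realType) (T : rtree) (D : nat) (w : T -> R) (h : nat).
Variable delta : R.
Hypotheses (leavesD : leaves_at_depth T D) (D_gt0 : (0 < D)%N).
Hypotheses (delta_gt0 : 0 < delta) (delta_le1 : delta <= 1).
Implicit Types (u : T) (a : atom T) (q x : atom T -> R) (r : leaf T).

(* A server of mass [1 - delta] at the leaf [r] and none elsewhere. *)
Definition single_server r a : R :=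
  if in_subtree (tag a) (val r) && (idx a == 0%N) then delta else 1.

Lemma single_server_le1 r a : single_server r a <= 1.
Proof. by rewrite /single_server; case: ifP. Qed.

Lemma single_server_feasible r : (0 < h)%N -> feasible h delta r (single_server r).
Proof.
move=> h0; have d0 := delta_gt0; have d1 := delta_le1; split.
- move=> a; apply/andP; split; last by have := single_server_le1 r a; lra.
  rewrite /lower /single_server; case: ifP => _; first by case: ifP.
  case: ifP => _; last by case: ifP => _; lra.
  case: ifP => [/andP[_ /eqP->]|_]; last by rewrite lern1 leq_b1.
  by rewrite leqNgt h0 /=; lra.
- by rewrite /single_server /= /in_subtree connect0 eqxx.
move=> u S nu su.
have cS : (#|S| <= #|leaves u|)%N by rewrite -card_chi // subset_leq_card.
(* At most one atom of [S] is worth [delta]: the first atom of the child above [r]. If it occurs,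
   the prefix at [u] starts with [delta] as well. *)
have [/existsP[a /andP[aS Ha]]|/existsPn none] :=
  boolP [exists a, (a \in S) && (in_subtree (tag a) (val r) && (idx a == 0%N))].
  have au : is_child (tag a) u by have := fintype.subsetP su _ aS; rewrite inE.
  have /andP[ra ia] := Ha.
  have ssa : single_server r a = delta by rewrite /single_server Ha.
  rewrite (big_setD1 a aS) /= ssa.
  rewrite [X in _ <= _ + X](eq_bigr (fun=> 1)); last first.
    move=> b; rewrite !inE /single_server => /andP[ba bS]; case: ifP => // /andP[rb ib].
    have bu : is_child (tag b) u by have := fintype.subsetP su _ bS; rewrite inE.
    case/eqP: ba; apply: atom_inj; first exact: child_uniq bu au rb ra.
    by rewrite (eqP ia) (eqP ib).
  rewrite sumr_const; move: cS; rewrite (cardsD1 a S) aS add1n; set n := #|_|.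
  elim: n => [lt|n IH lt].
    rewrite (prefix_sumS _ lt) /prefix_sum big1 ?add0r => [|b]; last by rewrite ltn0 andbF.
    by rewrite /single_server /= (child_in_subtree au ra) eqxx addr0.
  rewrite (prefix_sumS _ lt) mulrSr addrA lerD ?IH ?single_server_le1 //.
  exact: ltnW.
rewrite [leRHS](eq_bigr (fun=> 1)); last first.
  move=> a aS; rewrite /single_server; case: ifP => // Ha.
  by have := none a; rewrite aS Ha.
rewrite sumr_const -(mul1r (1 *+ _)) -(prefix_sum_cst _ cS).
by apply: prefix_sum_le => a _; apply: single_server_le1.
Qed.

Lemma step_exists r q : (0 < h)%N -> (forall a, 0 <= q a) ->
  exists x, step_to w h delta r q x.
Proof.
move=> h0 q0; apply: (@projection_exists _ _ _ _ _ _ _ delta_gt0 q 2) => //.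
- move=> z /polyhedronE [box _ _] a; case/andP: (box a) => la ->.
  by rewrite (le_trans (lower_ge0 h delta_gt0 a) la).
by exists (single_server r); apply/polyhedronE; apply: single_server_feasible.
Qed.

(** [h] servers spread evenly over the [n] leaves. All non-root atoms are equal, so the subset
    inequalities depend only on [#|S|]. *)
Definition uniform_start a : R :=
  if tag a == root T then (h <= idx a)%N%:R else 1 - h%:R / (nleaves T)%:R.

Lemma uniform_start_balanced :
  (h <= nleaves T)%N -> (0 < nleaves T)%N -> delta <= 1 - h%:R / (nleaves T)%:R ->
  balanced h delta uniform_start.
Proof.
move=> hn n0 dle; have d0 := delta_gt0; have nroot := root_nonleaf leavesD D_gt0.
set c := 1 - h%:R / (nleaves T)%:R in dle.
have nR : 0 < (nleaves T)%:R :> R by rewrite ltr0n.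
have c1 : c <= 1 by rewrite lerBlDr lerDl divr_ge0.
have chiE u a : a \in chi u -> uniform_start a = c.
  by rewrite inE => /andP[ar _]; rewrite /uniform_start (negPf ar).
have sumS u (S : {set atom T}) : S \subset chi u ->
    \sum_(a in S) uniform_start a = c * #|S|%:R.
  move=> su; rewrite (eq_bigr (fun=> c)) => [|a /(fintype.subsetP su)/chiE //].
  by rewrite sumr_const mulr_natr.
have preR n : (n <= nleaves T)%N -> prefix_sum uniform_start (root T) n = (n - h)%:R.
  move=> le; rewrite (@prefix_sum_values _ _ _ _ (fun j => (h <= j)%N%:R)).
  - exact: sum_ord_ge.
  - by rewrite card_leaves_root.
  - by move=> a ar; rewrite /uniform_start ar eqxx.
have preN u n : u != root T -> (n <= #|leaves u|)%N ->
    prefix_sum uniform_start u n = c * n%:R.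
  move=> ur le; rewrite -(prefix_sum_cst _ le); apply: eq_bigr => a /andP[/eqP au _].
  by rewrite /uniform_start au (negPf ur).
split.
- move=> a; rewrite /lower /uniform_start.
  have [ar|nr] := eqVneq (tag a) (root T).
    by rewrite ar (negPf nroot) lexx lern1 leq_b1.
  by rewrite -/c c1 andbT; case: ifP => // _; lra.
- by move=> a ar; rewrite /uniform_start ar eqxx.
- move=> u S nu su; have cS : (#|S| <= #|leaves u|)%N.
    by rewrite -card_chi // subset_leq_card.
  rewrite (sumS _ _ su); have [ur|nr] := eqVneq u (root T); last by rewrite preN.
  rewrite ur card_leaves_root in cS *; rewrite preR //.
  (* The claim is [max (#|S| - h) 0 <= (1 - h / n) * #|S|], which follows from [#|S| <= n]. *)
  have [le|/ltnW lt] := leqP #|S| h.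
    by rewrite (_ : (_ - _)%N = 0%N) ?mulr_ge0 //; [lra | apply/eqP; rewrite subn_eq0].
  rewrite natrB // mulrBl mul1r lerD2l lerN2 mulrAC ler_pdivrMr //.
  by rewrite ler_wpM2l // ler_nat.
- move=> a b tab le; rewrite /uniform_start tab; case: ifP => // _.
  by rewrite ler_nat; case: (leqP h (idx a)) => // ha; rewrite (leq_trans ha le).
- move=> u nu; rewrite (sumS u) // card_chi // -(@prefix_sum_all _ _ _ _ #|leaves u|) //.
  have [->|nr] := eqVneq u (root T); last by rewrite preN.
  rewrite card_leaves_root preR // natrB // mulrBl mul1r divfK //.
  exact: lt0r_neq0.
Qed.

(** The level-by-level chain is applied to [q] and to [- q]. *)
Lemma balanced_leaf_sum q : (h <= nleaves T)%N -> balanced h delta q ->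
  \sum_(l : leaf T) q (leaf_atom l) = (nleaves T)%:R - h%:R.
Proof.
move=> hn [_ qroot _ _ qtot]; rewrite -natrB // -(sum_root_indic qroot).
apply/eqP; rewrite eq_le; apply/andP; split; last first.
  by apply: (leaf_sum_ge leavesD) => u nu; rewrite qtot.
rewrite -lerN2 -!sumrN; apply: (leaf_sum_ge (x := fun a => - q a) leavesD) => u nu.
by rewrite !sumrN qtot.
Qed.

Lemma balanced_antiserver_ge (x : {ffun atom T -> R}) :
  balanced h delta x -> antiserver_ge h delta x.
Proof.
move=> xI; have x0 := balanced_ge0 delta_gt0 xI; case: xI => box xroot dom _ _.
split; last first.
  move=> l; case/andP: (box (leaf_atom l)) => + _.
  by rewrite /lower /= (valP l).
apply/antiserverE; split=> // a; last by move/xroot->.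
by rewrite x0; case/andP: (box a).
Qed.

End Existence.

(** * Bounds on delta and assembly of the online algorithm *)

Lemma delta_of_bounds (R : realType) (h k n : nat) :
  (1 <= h <= k)%N -> (k < n)%N ->
  [/\ 0 < delta_of R h k, delta_of R h k <= 1 & delta_of R h k <= 1 - h%:R / n%:R].
Proof.
move=> /andP[h1 hk] kn; rewrite /delta_of.
have hkR : h%:R <= k%:R :> R by rewrite ler_nat.
have h0 : 1 <= h%:R :> R by rewrite ler1n.
have knR : k%:R + 1 <= n%:R :> R by rewrite natr1 ler_nat.
have k2 : 0 < k%:R + 2^-1 :> R by lra.
split.
- by rewrite divr_gt0 //; lra.
- by rewrite ler_pdivrMr //; lra.
(* Since [delta = 1 - h / (k + 1/2)], this bound follows from [k + 1/2 <= n]; it makes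
   [uniform_start] satisfy the leaf bound. *)
rewrite ler_pdivrMr // mulrBl mul1r.
suff : h%:R / n%:R * (k%:R + 2^-1) <= h%:R :> R by lra.
rewrite mulrAC ler_pdivrMr; last by lra.
by rewrite ler_wpM2l //; lra.
Qed.

Lemma historyS (X : Type) (r : nat -> X) t :
  history r t.+1 = rcons (history r t) (r t.+1).
Proof. by rewrite /history -{1}[t.+1]addn1 iotaD map_cat /= cats1 add1n. Qed.

Theorem mainTheorem6 (R : realType) :
  exists C : R, 0 < C /\
  forall (T : rtree) (D : nat) (w : T -> R) (h k : nat),
    leaves_at_depth T D ->
    (forall u : T, 0 < w u) ->
    (1 <= h <= k)%N ->
    (k < nleaves T)%N ->
    let delta : R := delta_of R h k in
    exists (alg : seq (leaf T) -> {ffun atom T -> R}) (C' : R),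
    forall r : nat -> leaf T,
      let x := fun t : nat => alg (history r t) in
      [/\ forall t : nat, antiserver_ge h delta (x t),
          forall t : nat, (1 <= t)%N -> x t (leaf_atom (r t)) = delta,
          forall t : nat,
            \sum_(l : leaf T) x t (leaf_atom l) = (nleaves T)%:R - h%:R
        & forall (T0 : nat) (y : nat -> {ffun atom T -> R}),
            (forall t : nat, (t <= T0)%N -> antiserver h (y t) /\ integral (y t)) ->
            (forall t : nat, (1 <= t <= T0)%N -> y t (leaf_atom (r t)) = 0) ->
            let costx := \sum_(1 <= t < T0.+1) tree_norm w (x t - x t.-1) in
            let costy := \sum_(1 <= t < T0.+1) tree_norm w (y t - y t.-1) in
            let disty := \sum_(1 <= t < T0.+1)
              leaf_dist w (leaf_restr (y t)) (leaf_restr (y t.-1)) in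
            [/\ costx <= C * (D%:R * ln (1 + delta^-1)) * costy + C',
                costx <= C * (D%:R * ln (1 + delta^-1)) * disty + C'
              & (forall t : nat, (t <= T0)%N ->
                   exists A : {set leaf T}, y t = config_vec R A) ->
                costy = disty]].
Proof.
exists 4; split=> // T D w h k leavesD w0 hk kn delta.
have [d0 d1 dn] := delta_of_bounds R hk kn; rewrite -/delta in d0 d1 dn.
have [h0 hk'] := andP hk.
have hn : (h <= nleaves T)%N by apply: leq_trans hk' (ltnW kn).
(* With [D = 0] the root would be the only possible leaf, against [1 <= k < n]. *)
have D0 : (0 < D)%N.
  rewrite lt0n; apply/eqP => DE.
  have n1 : (nleaves T <= 1)%N.
    apply/card_le1_eqP => l l' _ _; apply: val_inj.
    have := leavesD l; have := leavesD l'; rewrite DE.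
    by move=> /eqP; rewrite depth_eq0 => /eqP -> /eqP; rewrite depth_eq0 => /eqP ->.
  by move: hk kn n1; lia.
(* One step map is chosen for all pairs; where the invariant fails, its value is the default [q]. *)
have /choice[step stepP] : forall qr : {ffun atom T -> R} * leaf T,
    exists f : {ffun atom T -> R},
    balanced h delta qr.1 -> step_to w h delta qr.2 qr.1 f.
  move=> [q r] /=; have [qI|nqI] := pselect (balanced h delta q); last by exists q.
  have [x xP] := step_exists w d0 d1 r h0 (balanced_ge0 d0 qI).
  exists [ffun a => x a] => _.
  by rewrite (_ : fun_of_fin [ffun a => x a] = x) //; apply/funext => a; rewrite ffunE.
pose x0 : {ffun atom T -> R} := [ffun a => uniform_start R h a].
have x0I : balanced h delta x0.
  rewrite (_ : fun_of_fin _ = uniform_start R h); last first.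
    by apply/funext => a; rewrite ffunE.
  by apply: uniform_start_balanced => //; apply: leq_ltn_trans kn.
(* Folding the step over the history makes the algorithm online by construction. *)
exists (foldl (fun q r => step (q, r)) x0).
exists (4 * D%:R * (\sum_a wat w a * (1 + delta) * ln (1 + delta^-1)) +
   \sum_a wat w a * (4 * D%:R + 1)) => r x.
have xS t : x t.+1 = step (x t, r t.+1) by rewrite /x historyS foldl_rcons.
have xI t : balanced h delta (x t).
  elim: t => [//|t IH]; rewrite xS.
  exact: (step_balanced leavesD D0 w0 d0 IH (stepP (x t, r t.+1) IH)).
have xP t : step_to w h delta (r t.+1) (x t) (x t.+1).
  by rewrite xS; exact: (stepP (x t, r t.+1) (xI t)).
split.
- by move=> t; apply: balanced_antiserver_ge.
- by move=> [//|t] _; apply: step_request (xP t).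
- by move=> t; apply: (balanced_leaf_sum leavesD hn (xI t)).
move=> T0 y yP yr costx costy disty.
(* Stated for arbitrary [z]: it is applied to [y] and to the encodings of its server sets. *)
have bound (z : nat -> {ffun atom T -> R}) :
    (forall t, (t <= T0)%N -> antiserver h (z t)) ->
    (forall t, (1 <= t <= T0)%N -> z t (leaf_atom (r t)) = 0) ->
    costx <= 4 * (D%:R * ln (1 + delta^-1)) *
      (\sum_(1 <= t < T0.+1) tree_norm w (z t - z t.-1)) +
      (4 * D%:R * (\sum_a wat w a * (1 + delta) * ln (1 + delta^-1)) +
       \sum_a wat w a * (4 * D%:R + 1)).
  have normB (f g : {ffun atom T -> R}) :
      tree_norm w (f - g) = \sum_a wat w a * `|f a - g a|.
    by rewrite tree_normE; apply: eq_bigr => a _; rewrite ffun_subE.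
  move=> zA zr; rewrite /costx; under eq_bigr do rewrite normB.
  under [in X in _ <= _ * X + _]eq_bigr do rewrite normB.
  apply: (run_cost leavesD D0 w0 d0 (r := r) (x := fun t => x t)
    (y := fun t => z t)) => //.
  by move=> t tT; apply/antiserverE; apply: zA.
split.
- by apply: bound => // t /yP[].
(* An integral point need not encode its server set. Replacing it by that encoding keeps the leaf
   values, and between encodings the tree norm is the leaf distance. *)
- have -> : disty = \sum_(1 <= t < T0.+1)
      tree_norm w (config_vec R (servers (y t)) - config_vec R (servers (y t.-1))).
    apply: eq_big_nat => t /andP[t1 tT]; rewrite tree_norm_config.
    by rewrite !leaf_restr_servers //; [case: (yP t.-1) => //; lia | case: (yP t)].
  apply: (bound (fun t => config_vec R (servers (y t)))) => t tT.
    have [yA yi] := yP t tT.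
    exact: antiserver_config (card_servers leavesD hn yA yi).
  by rewrite config_vec_leaf inE yr // eqxx.
move=> conf; apply: eq_big_nat => t /andP[t1 tT].
have [A ->] := conf t tT; have [|B ->] := conf t.-1; first by lia.
exact: tree_norm_config.
Qed.
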